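(* Let $t\ge 1$ be an integer and let $\{\mathbf{x}_k\}_{k\ge 0}\subset \mathrm{St}(d,r)^N$ be generated by the DRCS iteration $x_{i,k+1}=\mathrm{Retr}_{x_{i,k}}\big(-\alpha\,\mathrm{grad}\,\varphi^t_i(\mathbf{x}_k)\big)$, $i\in[N]$, with constant step-size $\alpha>0$. (1) Let $\nu\in(0,1)$, suppose $t\ge\lceil\log_{\sigma_2}(\tfrac{1}{2\sqrt N})\rceil$, $\mathbf{x}_0\in\mathcal{N}_{R,t}$, and $0<\alpha\le\min\{\tfrac{\nu\Phi}{L_t},1,\tfrac1M\}$, where $\Phi=2-\|\mathbf{x}-\bar{\mathbf{x}}\|_{F,\infty}^2$ and the bound involving $\Phi$ is required with $\mathbf{x}=\mathbf{x}_k$ for every $k\ge 0$. Then $\mathbf{x}_k\in\mathcal{N}_{R,t}$ for all $k\ge0$ and $$\|\mathbf{x}_k-\bar{\mathbf{x}}_k\|_F^2\le\big(1-2\alpha(1-\nu)\gamma_{R,t}\big)^k\,\|\mathbf{x}_0-\bar{\mathbf{x}}_0\|_F^2\qquad\text{for all }k\ge 0,$$ where $\gamma_{R,t}=(1-4r\delta_{1,t}^2)(1-\tfrac{\delta_{2,t}^2}{2})\mu_t$. Moreover, if in addition $\alpha\le\tfrac{1}{2MG+L_t}$, then $\bar{\mathbf{x}}_k$ converges to a single point. (2) Let $t\ge1$ be arbitrary, suppose $\mathbf{x}_0\in\mathcal{N}_{l,t}$ and $0<\alpha\le\min\{\tfrac{2}{L_t+2MG},\tfrac{\Phi}{2L_t}\}$,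 where $\Phi=2-\|\mathbf{x}-\bar{\mathbf{x}}\|_F^2$ and the bound involving $\Phi$ is required with $\mathbf{x}=\mathbf{x}_k$ for every $k\ge0$. Then, with $\nu=\tfrac12$, $$\|\mathbf{x}_k-\bar{\mathbf{x}}_k\|_F^2\le\big(1-2\alpha(1-\nu)\gamma_{l,t}\big)^k\,\|\mathbf{x}_0-\bar{\mathbf{x}}_0\|_F^2\qquad\text{for all }k\ge 0,$$ where $\gamma_{l,t}=\mu_t(1-4r\delta_{3,t}^2)-\varphi^t(\mathbf{x}_0)$.
   Context: Let $1\le r\le d$ and $N\ge2$ be integers, $[N]=\{1,\dots,N\}$, and $\mathrm{St}(d,r)=\{x\in\mathbb{R}^{d\times r}:x^\top x=I_r\}$. Inner products are $\langle x,y\rangle=\mathrm{Tr}(x^\top y)$ and $\|\cdot\|_F$ is the Frobenius norm, applied also to stacked tuples $\mathbf{x}=(x_1,\dots,x_N)$. $W\in\mathbb{R}^{N\times N}$ is the communication matrix of a connected undirected graph on $N$ nodes; it is symmetric and doubly stochastic, $W_{ij}\ge0$, $0<W_{ii}<1$, its eigenvalues lie in $(-1,1]$, and its second largest singular value $\sigma_2$ lies in $[0,1)$. $W^t_{ij}$ is the $(i,j)$ entry of the $t$-th power $W^t$. $\lambda_2(W^t)$ and $\lambda_N(W^t)$ are the second largest and the smallest eigenvalue of $W^t$; $\mu_t:=1-\lambda_2(W^t)$ and $L_t:=1-\lambda_N(W^t)$. If $\sigma_2=0$ the condition $t\ge\lceil\log_{\sigma_2}(\frac1{2\sqrt N})\rceil$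 is read as $t\ge1$. $\varphi^t(\mathbf{x})=\frac14\sum_{i,j=1}^N W^t_{ij}\|x_i-x_j\|_F^2$. The Euclidean gradient has blocks $\nabla\varphi^t_i(\mathbf{x})=x_i-\sum_{j}W^t_{ij}x_j$, and the Riemannian gradient on $\mathrm{St}(d,r)^N$ has blocks $\mathrm{grad}\,\varphi^t_i(\mathbf{x})=\mathcal{P}_{T_{x_i}}(\nabla\varphi^t_i(\mathbf{x}))$ with $\mathcal{P}_{T_x}(y)=y-\frac12x(x^\top y+y^\top x)$ the orthogonal projection onto the tangent space. $G:=\max_{\mathbf{x}\in \mathrm{St}(d,r)^N}\|\mathrm{grad}\,\varphi^t(\mathbf{x})\|_F$. $\mathrm{Retr}_x(\xi)=(x+\xi)(I_r+\xi^\top\xi)^{-1/2}$ is the polar retraction, and $M>0$ is a constant such that $\|\mathrm{Retr}_x(\xi)-(x+\xi)\|_F\le M\|\xi\|_F^2$ for all $x\in\mathrm{St}(d,r)$ and all tangent vectors $\xi$ at $x$. For $\mathbf{x}\in\mathrm{St}(d,r)^N$, the induced arithmetic mean (IAM) $\bar x$ is a minimizer of $\sum_i\|y-x_i\|_F^2$ over $y\in\mathrm{St}(d,r)$, i.e. the orthogonal projection of $\frac1N\sum_ix_i$ onto $\mathrm{St}(d,r)$; $\bar{\mathbf{x}}=(\bar x,\dots,\bar x)$, and $\bar{\mathbf{x}}_k$ is the corresponding object for $\mathbf{x}_k$. $\|\mathbf{x}-\bar{\mathbf{x}}\|_{F,\infty}=\max_{i}\|x_i-\bar x\|_F$. Regions: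 $\mathcal{N}_{R,t}=\{\mathbf{x}\in \mathrm{St}(d,r)^N:\|\mathbf{x}-\bar{\mathbf{x}}\|_F^2\le N\delta_{1,t}^2\}\cap\{\mathbf{x}\in \mathrm{St}(d,r)^N:\|\mathbf{x}-\bar{\mathbf{x}}\|_{F,\infty}\le\delta_{2,t}\}$, where the positive constants satisfy $\delta_{1,t}\le\frac{1}{5\sqrt r}\delta_{2,t}$ and $\delta_{2,t}\le\frac16$. $\mathcal{N}_{l,t}=\{\mathbf{x}\in \mathrm{St}(d,r)^N:\varphi^t(\mathbf{x})\le\frac{\mu_t}{4},\ \|\mathbf{x}-\bar{\mathbf{x}}\|_F^2\le N\delta_{3,t}^2\}$, where the positive constant satisfies $\delta_{3,t}\le\min\{\frac1{\sqrt N},\frac1{4\sqrt r}\}$. *)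

(* Defs.v *)
From HB Require Import structures.
From mathcomp Require Import all_boot all_order all_algebra.
From mathcomp Require Import all_classical all_reals all_analysis.

Set Implicit Arguments.
Unset Strict Implicit.
Unset Printing Implicit Defensive.
Import Order.TTheory GRing.Theory Num.Theory.
Import numFieldNormedType.Exports.
Local Open Scope classical_set_scope.
Local Open Scope ring_scope.

(* The library norm [`|x|] on matrices is the sup norm, so the Frobenius
   inner product and norm are introduced separately. *)
Definition inner (R : realType) (d r : nat) (x y : 'M[R]_(d, r)) : R :=
  \tr (x^T *m y).

Definition fnorm (R : realType) (d r : nat) (x : 'M[R]_(d, r)) : R :=
  Num.sqrt (inner x x).

Definition tuple_fnorm (R : realType) (N d r : nat)
    (x : 'I_N -> 'M[R]_(d, r)) : R :=
  Num.sqrt (\sum_(i < N) fnorm (x i) ^+ 2).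

Definition tuple_fnorm_inf (R : realType) (N d r : nat)
    (x : 'I_N -> 'M[R]_(d, r)) : R :=
  \big[Num.max/0]_(i < N) fnorm (x i).

(* The tuple x - (y, ..., y). *)
Definition dev (R : realType) (N d r : nat)
    (x : 'I_N -> 'M[R]_(d, r)) (y : 'M[R]_(d, r)) : 'I_N -> 'M[R]_(d, r) :=
  fun i => x i - y.

Definition stiefel (R : realType) (d r : nat) : set 'M[R]_(d, r) :=
  [set x | x^T *m x = 1%:M].

Definition stiefelN (R : realType) (N d r : nat) :
    set ('I_N -> 'M[R]_(d, r)) :=
  [set x | forall i, stiefel (x i)].

Definition tangent (R : realType) (d r : nat) (x : 'M[R]_(d, r)) :
    set 'M[R]_(d, r) :=
  [set xi | x^T *m xi + xi^T *m x = 0].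

Definition tangent_proj (R : realType) (d r : nat) (x y : 'M[R]_(d, r)) :
    'M[R]_(d, r) :=
  y - 2^-1 *: (x *m (x^T *m y + y^T *m x)).

Definition psd (R : realType) (n : nat) (A : 'M[R]_n) : Prop :=
  A^T = A /\ forall v : 'cV[R]_n, 0 <= (v^T *m A *m v) 0 0.

(* The positive semidefinite square root; it exists and is unique as soon as A
   is positive semidefinite (and is 0 by convention when there is none). *)
Definition sqrtmx (R : realType) (n : nat) (A : 'M[R]_n) : 'M[R]_n :=
  xget 0 [set B | psd B /\ B *m B = A].

Definition polar_retr (R : realType) (d r : nat) (x xi : 'M[R]_(d, r)) :
    'M[R]_(d, r) :=
  (x + xi) *m invmx (sqrtmx (1%:M + xi^T *m xi)).

(* The eigenvalues listed with multiplicity in nonincreasing order; the list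
   exists (and is unique) when the characteristic polynomial splits over R, in
   particular when A is symmetric. *)
Definition eigvals (R : realType) (n : nat) (A : 'M[R]_n) : seq R :=
  xget [::] [set s : seq R | sorted >=%R s /\
                             char_poly A = \prod_(a <- s) ('X - a%:P)].

(* k-th largest, counting from k = 1. *)
Definition nth_eigval (R : realType) (n k : nat) (A : 'M[R]_n) : R :=
  nth 0 (eigvals A) k.-1.

Definition nth_singval (R : realType) (n k : nat) (A : 'M[R]_n) : R :=
  Num.sqrt (nth_eigval k (A^T *m A)).

Record communication_matrix (R : realType) (N : nat) (e : rel 'I_N)
    (W : 'M[R]_N) : Prop := CommunicationMatrix {
  graph_sym : symmetric e;
  graph_irrefl : irreflexive e;
  graph_connected : forall i j, connect e i j;
  comm_edge : forall i j, i != j -> (0 < W i j) = e i j;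
  comm_sym : W^T = W;
  comm_row_sum : forall i, \sum_(j < N) W i j = 1;
  comm_col_sum : forall j, \sum_(i < N) W i j = 1;
  comm_ge0 : forall i j, 0 <= W i j;
  comm_diag : forall i, 0 < W i i < 1;
  comm_eigenvalue : forall a, eigenvalue W a -> -1 < a <= 1;
  comm_singval : 0 <= nth_singval 2 W < 1
}.

Definition mu (R : realType) (N : nat) (W : 'M[R]_N) (t : nat) : R :=
  1 - nth_eigval 2 (W ^+ t).

Definition Lip (R : realType) (N : nat) (W : 'M[R]_N) (t : nat) : R :=
  1 - nth_eigval N (W ^+ t).

(* t >= ceil (log_sigma (1 / (2 sqrt N))) with sigma the second largest
   singular value of W; the logarithm has no meaning in base 0. *)
Definition enough_rounds (R : realType) (N : nat) (W : 'M[R]_N) (t : nat) :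
    Prop :=
  let sigma := nth_singval 2 W in
  if sigma == 0 then (1 <= t)%N
  else Num.ceil (ln (1 / (2 * Num.sqrt N%:R)) / ln sigma) <= t%:Z.

Definition phi (R : realType) (N d r : nat) (W : 'M[R]_N) (t : nat)
    (x : 'I_N -> 'M[R]_(d, r)) : R :=
  4^-1 * \sum_(i < N) \sum_(j < N) (W ^+ t) i j * fnorm (x i - x j) ^+ 2.

Definition egrad (R : realType) (N d r : nat) (W : 'M[R]_N) (t : nat)
    (x : 'I_N -> 'M[R]_(d, r)) : 'I_N -> 'M[R]_(d, r) :=
  fun i => x i - \sum_(j < N) (W ^+ t) i j *: x j.

Definition rgrad (R : realType) (N d r : nat) (W : 'M[R]_N) (t : nat)
    (x : 'I_N -> 'M[R]_(d, r)) : 'I_N -> 'M[R]_(d, r) :=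
  fun i => tangent_proj (x i) (egrad W t x i).

(* The supremum is a maximum since the product of Stiefel manifolds is compact
   (and nonempty when r <= d). *)
Definition rgrad_max (R : realType) (N d r : nat) (W : 'M[R]_N) (t : nat) : R :=
  sup [set tuple_fnorm (rgrad W t x) | x in @stiefelN R N d r].

Definition retr_second_order (R : realType) (d r : nat) (M : R) : Prop :=
  forall x xi : 'M[R]_(d, r), stiefel x -> tangent x xi ->
    fnorm (polar_retr x xi - (x + xi)) <= M * fnorm xi ^+ 2.

Definition is_drcs (R : realType) (N d r : nat) (W : 'M[R]_N) (t : nat)
    (alpha : R) (x : nat -> 'I_N -> 'M[R]_(d, r)) : Prop :=
  forall k i, x k.+1 i = polar_retr (x k i) (- (alpha *: rgrad W t (x k) i)).

(* The minimizer need not be unique, so an induced arithmetic mean is a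
   property of y; [iam_selection] is an arbitrary choice of one minimizer for
   each tuple. *)
Definition is_iam (R : realType) (N d r : nat) (x : 'I_N -> 'M[R]_(d, r))
    (y : 'M[R]_(d, r)) : Prop :=
  stiefel y /\
  forall z, stiefel z ->
    \sum_(i < N) fnorm (y - x i) ^+ 2 <= \sum_(i < N) fnorm (z - x i) ^+ 2.

Definition iam_selection (R : realType) (N d r : nat)
    (iam : ('I_N -> 'M[R]_(d, r)) -> 'M[R]_(d, r)) : Prop :=
  forall x, stiefelN x -> is_iam x (iam x).

Definition region_R (R : realType) (N d r : nat)
    (iam : ('I_N -> 'M[R]_(d, r)) -> 'M[R]_(d, r)) (delta1 delta2 : R) :
    set ('I_N -> 'M[R]_(d, r)) :=
  [set x | stiefelN x /\
     tuple_fnorm (dev x (iam x)) ^+ 2 <= N%:R * delta1 ^+ 2] `&`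
  [set x | stiefelN x /\ tuple_fnorm_inf (dev x (iam x)) <= delta2].

Definition region_l (R : realType) (N d r : nat) (W : 'M[R]_N) (t : nat)
    (iam : ('I_N -> 'M[R]_(d, r)) -> 'M[R]_(d, r)) (delta3 : R) :
    set ('I_N -> 'M[R]_(d, r)) :=
  [set x | [/\ stiefelN x, phi W t x <= mu W t / 4 &
     tuple_fnorm (dev x (iam x)) ^+ 2 <= N%:R * delta3 ^+ 2]].

Definition gamma_R (R : realType) (N : nat) (W : 'M[R]_N) (t r : nat)
    (delta1 delta2 : R) : R :=
  (1 - 4 * r%:R * delta1 ^+ 2) * (1 - delta2 ^+ 2 / 2) * mu W t.

Definition gamma_l (R : realType) (N d r : nat) (W : 'M[R]_N) (t : nat)
    (delta3 : R) (x0 : 'I_N -> 'M[R]_(d, r)) : R :=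
  mu W t * (1 - 4 * r%:R * delta3 ^+ 2) - phi W t x0.

(* Main.v *)
Require Import Defs.
From HB Require Import structures.
From mathcomp Require Import all_boot all_order all_algebra.
From mathcomp Require Import all_classical all_reals all_analysis.
From mathcomp Require Import ring lra.
From mathcomp Require Import complex spectral.

Set Implicit Arguments.
Unset Strict Implicit.
Unset Printing Implicit Defensive.
Import Order.TTheory GRing.Theory Num.Theory.
Import numFieldNormedType.Exports.
Local Open Scope classical_set_scope.
Local Open Scope ring_scope.

(* The polar retraction z of v = x_i - alpha g_i satisfies |z - y| <= |v - y| for
   every y on the Stiefel manifold, and xbar+ minimizes the distance to x+, so
     |x+ - xbar+|^2 <= |x - xbar|^2 - 2 alpha <x - xbar, g> + alpha^2 |g|^2.
   The normal part of the Euclidean gradient at x_i is x_i Q_i / 2 with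
   Q_i = sum_j W^t_ij (x_i - x_j)^T (x_i - x_j) positive semidefinite, and
   <x_i - y, x_i Q_i> = tr((x_i - y) Q_i (x_i - y)^T) / 2 for y on the manifold.
   Hence <x - xbar, g> >= (2 - max_i |x_i - xbar|^2) phi(x), while
   |g|^2 <= 2 L phi(x): the step-size condition absorbs the quadratic term, and
   2 phi(x) >= mu |x - mean|^2 gives the contraction, because xbar is the polar
   factor of the mean and |mean - xbar| <= |x - xbar|^2 / (2N).
   In (1), the bound on the largest deviation survives a step because t rounds
   bring the rows of W^t within 1/(2 sqrt N) of 1/N, and xbar moves by
   O(alpha |x - xbar|^2 / N), which also makes xbar_k Cauchy. In (2), phi does
   not increase along the iteration. *)

(** * Frobenius inner product and positive semidefinite matrices *)

(** The obstacle is curvature: mean, retraction and gradient agree with their linear counterparts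
    only to first order, so the first-order terms must cancel exactly before anything is estimated.
    Two facts do this. The Euclidean gradients sum to zero, and <x C, x - y> = <(x - y) C, x - y> /
    2 for symmetric C and x, y on the manifold. With C = Q_i the identity gives the sign of the
    normal component, with C the excess of the polar factor over I it gives the retraction
    inequality, and with C = S below it makes the projection of the mean Lipschitz. The mean xbar is
    only known as some minimizer, chosen arbitrarily. Comparing it with Q^T xbar, Q orthogonal,
    yields mean = xbar S with 0 <= S <= I, and the distances on the manifold give tr (I - S) = |x -
    xbar|^2 / (2N). Traces of positive semidefinite matrices dominate their Frobenius norms, so this
    one number controls both |mean - xbar| and the distance from S to I. In (2) [t] may be too small
    for the mixing estimate; the total deviation, which the step itself decreases, then replaces the
    largest one. *)

Section FrobeniusInner.
Context {R : realType}.

Lemma innerE d r (x y : 'M[R]_(d, r)) :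
  inner x y = \sum_i \sum_j x i j * y i j.
Proof.
rewrite /inner /mxtrace exchange_big; apply: eq_bigr => j _.
by rewrite mxE; apply: eq_bigr => i _; rewrite mxE.
Qed.

Lemma innerC d r (x y : 'M[R]_(d, r)) : inner x y = inner y x.
Proof. by rewrite /inner -mxtrace_tr trmx_mul trmxK. Qed.

Lemma innerDr d r (x y z : 'M[R]_(d, r)) : inner x (y + z) = inner x y + inner x z.
Proof. by rewrite /inner mulmxDr mxtraceD. Qed.

Lemma innerDl d r (x y z : 'M[R]_(d, r)) : inner (x + y) z = inner x z + inner y z.
Proof. by rewrite innerC innerDr !(innerC z). Qed.

Lemma innerZr d r a (x y : 'M[R]_(d, r)) : inner x (a *: y) = a * inner x y.
Proof. by rewrite /inner -scalemxAr mxtraceZ. Qed.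

Lemma innerZl d r a (x y : 'M[R]_(d, r)) : inner (a *: x) y = a * inner x y.
Proof. by rewrite innerC innerZr innerC. Qed.

Lemma innerNr d r (x y : 'M[R]_(d, r)) : inner x (- y) = - inner x y.
Proof. by rewrite -scaleN1r innerZr mulN1r. Qed.

Lemma innerNl d r (x y : 'M[R]_(d, r)) : inner (- x) y = - inner x y.
Proof. by rewrite innerC innerNr innerC. Qed.

Lemma innerBr d r (x y z : 'M[R]_(d, r)) : inner x (y - z) = inner x y - inner x z.
Proof. by rewrite innerDr innerNr. Qed.

Lemma innerBl d r (x y z : 'M[R]_(d, r)) : inner (x - y) z = inner x z - inner y z.
Proof. by rewrite innerDl innerNl. Qed.

Lemma inner0r d r (x : 'M[R]_(d, r)) : inner x 0 = 0.
Proof. by rewrite /inner mulmx0 mxtrace0. Qed.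

Lemma inner0l d r (x : 'M[R]_(d, r)) : inner 0 x = 0.
Proof. by rewrite innerC inner0r. Qed.

Lemma inner_sumr d r (I : finType) (x : 'M[R]_(d, r)) (y : I -> 'M[R]_(d, r)) :
  inner x (\sum_i y i) = \sum_i inner x (y i).
Proof. by apply: (big_morph (inner x) (innerDr x) (inner0r x)). Qed.

Lemma inner_suml d r (I : finType) (x : 'M[R]_(d, r)) (y : I -> 'M[R]_(d, r)) :
  inner (\sum_i y i) x = \sum_i inner (y i) x.
Proof. by rewrite innerC inner_sumr; apply: eq_bigr => i _; rewrite innerC. Qed.

Lemma inner_mull d d' r (A : 'M[R]_(d, d')) (x : 'M[R]_(d', r)) (y : 'M[R]_(d, r)) :
  inner (A *m x) y = inner x (A^T *m y).
Proof. by rewrite /inner trmx_mul mulmxA. Qed.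

Lemma inner_mulr d r r' (x : 'M[R]_(d, r')) (A : 'M[R]_(r', r)) (y : 'M[R]_(d, r)) :
  inner (x *m A) y = inner x (y *m A^T).
Proof. by rewrite /inner trmx_mul -mulmxA mxtrace_mulC mulmxA. Qed.

Lemma inner_tr d r (x y : 'M[R]_(d, r)) : inner x^T y^T = inner x y.
Proof. by rewrite /inner trmxK mxtrace_mulC -mxtrace_tr trmx_mul trmxK. Qed.

Lemma inner1l n (A : 'M[R]_n) : inner 1%:M A = \tr A.
Proof. by rewrite /inner trmx1 mul1mx. Qed.

Lemma inner_qform n (A : 'M[R]_n) (v : 'cV[R]_n) :
  inner v (A *m v) = (v^T *m A *m v) 0 0.
Proof. by rewrite /inner mulmxA trace_mx11. Qed.

Lemma inner_ge0 d r (x : 'M[R]_(d, r)) : 0 <= inner x x.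
Proof.
rewrite innerE; apply: sumr_ge0 => i _; apply: sumr_ge0 => j _.
by rewrite -expr2 sqr_ge0.
Qed.

Lemma inner_eq0 d r (x : 'M[R]_(d, r)) : inner x x = 0 -> x = 0.
Proof.
rewrite innerE => /psumr_eq0P h; apply/matrixP => i j; rewrite mxE.
have {}h : \sum_j x i j * x i j = 0.
  by apply: h => // k _; apply: sumr_ge0 => l _; rewrite -expr2 sqr_ge0.
move/psumr_eq0P: h => h; apply/eqP; rewrite -sqrf_eq0 expr2; apply/eqP.
by apply: h => // l _; rewrite -expr2 sqr_ge0.
Qed.

Lemma fnorm_ge0 d r (x : 'M[R]_(d, r)) : 0 <= fnorm x.
Proof. exact: sqrtr_ge0. Qed.

Lemma sqr_fnorm d r (x : 'M[R]_(d, r)) : fnorm x ^+ 2 = inner x x.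
Proof. by rewrite sqr_sqrtr ?inner_ge0. Qed.

Lemma fnorm_eq0 d r (x : 'M[R]_(d, r)) : fnorm x = 0 -> x = 0.
Proof. by move=> h; apply: inner_eq0; rewrite -sqr_fnorm h expr0n. Qed.

Lemma fnorm0 d r : fnorm (0 : 'M[R]_(d, r)) = 0.
Proof. by rewrite /fnorm inner0r sqrtr0. Qed.

Lemma fnormZ d r a (x : 'M[R]_(d, r)) : fnorm (a *: x) = `|a| * fnorm x.
Proof.
by rewrite /fnorm innerZl innerZr mulrA -expr2 sqrtrM ?sqr_ge0// sqrtr_sqr.
Qed.

Lemma fnormN d r (x : 'M[R]_(d, r)) : fnorm (- x) = fnorm x.
Proof. by rewrite /fnorm innerNl innerNr opprK. Qed.

Lemma fnormC d r (x y : 'M[R]_(d, r)) : fnorm (x - y) = fnorm (y - x).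
Proof. by rewrite -fnormN opprB. Qed.

Lemma ler_sq (a b : R) : 0 <= b -> a ^+ 2 <= b ^+ 2 -> a <= b.
Proof. by move=> b0 h; rewrite leNgt; apply/negP => ba; nra. Qed.

Lemma inner_CS d r (x y : 'M[R]_(d, r)) : inner x y <= fnorm x * fnorm y.
Proof.
have [y0|y0] := eqVneq (inner y y) 0.
  by rewrite (inner_eq0 y0) inner0r fnorm0 mulr0.
have yp : 0 < inner y y by rewrite lt_def y0 inner_ge0.
apply: ler_sq; first by rewrite mulr_ge0 ?fnorm_ge0.
rewrite exprMn !sqr_fnorm.
have := inner_ge0 (inner y y *: x - inner x y *: y).
rewrite innerBl !innerBr !innerZl !innerZr (innerC y x) => h.
have : 0 <= inner y y * (inner x x * inner y y - inner x y ^+ 2).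
  by move: h; set a := inner x x; set b := inner y y; set c := inner x y; nra.
by rewrite pmulr_rge0// subr_ge0.
Qed.

Lemma fnormD d r (x y : 'M[R]_(d, r)) : fnorm (x + y) <= fnorm x + fnorm y.
Proof.
apply: ler_sq; first by rewrite addr_ge0 ?fnorm_ge0.
rewrite sqrrD !sqr_fnorm innerDl !innerDr (innerC y x).
have := inner_CS x y; set a := inner x x; set b := inner y y; lra.
Qed.

Lemma fnorm_sum d r (I : finType) (F : I -> 'M[R]_(d, r)) :
  fnorm (\sum_i F i) <= \sum_i fnorm (F i).
Proof.
apply: (big_ind2 (fun x y => fnorm x <= y)) => //; first by rewrite fnorm0.
by move=> x1 x2 y1 y2 h1 h2; rewrite (le_trans (fnormD _ _))// lerD.
Qed.

Lemma CS_sum (I : finType) (a b : I -> R) :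
  \sum_i a i * b i <= Num.sqrt (\sum_i a i ^+ 2) * Num.sqrt (\sum_i b i ^+ 2).
Proof.
pose m (f : I -> R) : 'rV[R]_#|I| := \row_i f (enum_val i).
have mE f g : inner (m f) (m g) = \sum_i f i * g i.
  rewrite innerE big_ord1 [RHS](reindex _ (onW_bij _ (enum_val_bij I))) /=.
  by apply: eq_bigr => i _; rewrite !mxE.
have := inner_CS (m a) (m b); rewrite /fnorm !mE => h.
by apply: (le_trans h); rewrite le_eqVlt; apply/orP; left; apply/eqP;
  congr (Num.sqrt _ * Num.sqrt _); apply: eq_bigr => i _; rewrite expr2.
Qed.

Lemma fnorm_sumZ d r (I : finType) (c : I -> R) (F : I -> 'M[R]_(d, r)) :
  fnorm (\sum_i c i *: F i) <=
  Num.sqrt (\sum_i c i ^+ 2) * Num.sqrt (\sum_i fnorm (F i) ^+ 2).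
Proof.
apply: le_trans (fnorm_sum _) _.
under eq_bigr do rewrite fnormZ.
apply: le_trans (CS_sum _ _) _.
by under [X in Num.sqrt X * _ <= _]eq_bigr do rewrite real_normK ?num_real//.
Qed.

Lemma fnormM d e r (A : 'M[R]_(d, e)) (B : 'M[R]_(e, r)) :
  fnorm (A *m B) <= fnorm A * fnorm B.
Proof.
apply: ler_sq; first by rewrite mulr_ge0 ?fnorm_ge0.
rewrite exprMn !sqr_fnorm !innerE mulr_suml; apply: ler_sum => i _.
rewrite exchange_big /= mulr_sumr; apply: ler_sum => j _.
(* Both signs of the row are needed to bound the absolute value of the entry. *)
have := CS_sum (A i) (B^~ j); have := CS_sum (fun k => - A i k) (B^~ j).
have -> : \sum_k (- A i k) ^+ 2 = \sum_k A i k ^+ 2.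
  by apply: eq_bigr => k _; rewrite sqrrN.
have -> : \sum_k - A i k * B k j = - (A *m B) i j.
  by rewrite mxE -sumrN; apply: eq_bigr => k _; rewrite mulNr.
have -> : \sum_k A i k * B k j = (A *m B) i j by rewrite mxE.
set p := Num.sqrt _; set q := Num.sqrt _ => h1 h2.
have -> : \sum_j A i j * A i j = p ^+ 2.
  by rewrite sqr_sqrtr// sumr_ge0// => k _; rewrite sqr_ge0.
have -> : \sum_i B i j * B i j = q ^+ 2.
  by rewrite sqr_sqrtr// sumr_ge0// => k _; rewrite sqr_ge0.
rewrite -expr2 -exprMn -(real_normK (num_real ((A *m B) i j))).
by rewrite lerXn2r ?nnegrE ?mulr_ge0 ?sqrtr_ge0// ler_norml h2 lerNl h1.
Qed.

End FrobeniusInner.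

Section PositiveSemidefinite.
Context {R : realType}.

Lemma psdP n (A : 'M[R]_n) :
  psd A <-> A^T = A /\ forall v : 'cV[R]_n, 0 <= inner v (A *m v).
Proof. by split=> -[sA h]; split=> // v; have := h v; rewrite inner_qform. Qed.

Lemma psdD n (A B : 'M[R]_n) : psd A -> psd B -> psd (A + B).
Proof.
move=> /psdP[sA hA] /psdP[sB hB]; apply/psdP.
by split=> [|v]; rewrite ?linearD /= ?sA ?sB// mulmxDl innerDr addr_ge0.
Qed.

Lemma psdZ n a (A : 'M[R]_n) : 0 <= a -> psd A -> psd (a *: A).
Proof.
move=> a0 /psdP[sA hA]; apply/psdP.
by split=> [|v]; rewrite ?linearZ /= ?sA// -scalemxAl innerZr mulr_ge0.
Qed.

Lemma psd0 n : psd (0 : 'M[R]_n).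
Proof. by apply/psdP; split=> [|v]; rewrite ?trmx0// mul0mx inner0r. Qed.

Lemma psd_gram d n (E : 'M[R]_(d, n)) : psd (E^T *m E).
Proof.
apply/psdP; split=> [|v]; first by rewrite trmx_mul trmxK.
by rewrite -mulmxA innerC inner_mull trmxK inner_ge0.
Qed.

(** The inner product is the trace of D P D^T, a sum of quadratic forms of [P] at the rows of
    [D]. *)
Lemma psd_inner_mulr_ge0 d n (D : 'M[R]_(d, n)) (P : 'M[R]_n) :
  psd P -> 0 <= inner (D *m P) D.
Proof.
move=> /psdP[sP hP].
rewrite -inner_tr trmx_mul sP /inner /mxtrace; apply: sumr_ge0 => i _.
have := hP (col i D^T); rewrite innerC /inner trace_mx11.
by congr (_ <= _); rewrite !mxE; apply: eq_bigr => k _; rewrite !mxE; congr (_ * _);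
  apply: eq_bigr => l _; rewrite !mxE.
Qed.

Lemma psd_tr_ge0 n (P : 'M[R]_n) : psd P -> 0 <= \tr P.
Proof.
by move=> /(psd_inner_mulr_ge0 1%:M); rewrite mul1mx innerC inner1l.
Qed.

(** The 2 x 2 principal minors give P_ij^2 <= P_ii P_jj; summing over i and j turns the right side
    into the square of the trace. *)
Lemma psd_fnorm_le_tr n (P : 'M[R]_n) : psd P -> fnorm P <= \tr P.
Proof.
move=> hP; have t0 := psd_tr_ge0 hP; case/psdP: hP => sP hP.
have sE i j : P j i = P i j by rewrite -[in RHS]sP mxE.
have d0 i : 0 <= P i i.
  have := hP (delta_mx i 0); rewrite -colE /inner trace_mx11 trmx_delta -rowE.
  by rewrite !mxE.
have qE i j a b : inner (a *: delta_mx i 0 + b *: delta_mx j 0)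
    (P *m (a *: delta_mx i 0 + b *: delta_mx j 0 : 'cV_n)) =
    a ^+ 2 * P i i + 2 * a * b * P i j + b ^+ 2 * P j j.
  rewrite mulmxDr -!scalemxAr -!colE innerDl !innerDr !innerZl !innerZr.
  have e k l : inner (delta_mx k 0) (col l P) = P k l.
    by rewrite /inner trace_mx11 trmx_delta -rowE !mxE.
  by rewrite !e (sE i j); ring.
have h i j : P i j ^+ 2 <= P i i * P j j.
  (* The first two test vectors give the minor multiplied by P_jj or by P_ii; the third one settles
     the case where both diagonal entries vanish. *)
  have := hP (P j j *: delta_mx i 0 + - P i j *: delta_mx j 0); rewrite qE.
  have := hP (P i i *: delta_mx j 0 + - P i j *: delta_mx i 0); rewrite qE (sE i j).
  have := hP (P i j *: delta_mx i 0 + - 1 *: delta_mx j 0); rewrite qE.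
  have := d0 i; have := d0 j; set a := P i i; set b := P j j; set c := P i j.
  rewrite le_eqVlt => /predU1P[<-|b0]; last first.
    move=> a0 _ _ h; have : 0 <= b * (a * b - c ^+ 2) by nra.
    by rewrite pmulr_rge0// subr_ge0.
  rewrite le_eqVlt => /predU1P[<-|a0]; first by nra.
  move=> _ h _; have : 0 <= a * (a * 0 - c ^+ 2) by nra.
  by rewrite pmulr_rge0// subr_ge0.
apply: ler_sq => //; rewrite sqr_fnorm innerE expr2 {1}/mxtrace mulr_suml.
apply: ler_sum => i _; rewrite mulr_sumr; apply: ler_sum => j _.
by rewrite -expr2 h.
Qed.

Lemma psd_tr_sub n (P : 'M[R]_n) : psd P -> psd ((\tr P)%:M - P).
Proof.
move=> hP; have h := psd_fnorm_le_tr hP; case/psdP: hP => sP _.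
apply/psdP; split=> [|v]; first by rewrite linearB /= tr_scalar_mx sP.
rewrite mulmxBl mul_scalar_mx innerBr innerZr subr_ge0 -sqr_fnorm.
apply: le_trans (inner_CS _ _) _.
rewrite expr2 mulrCA ler_wpM2l ?fnorm_ge0// (le_trans (fnormM _ _))//.
by rewrite ler_wpM2r ?fnorm_ge0.
Qed.

End PositiveSemidefinite.

(** * Spectral theorem for real symmetric matrices *)

Section Spectral.
Context {R : realType}.

(** Reflection in the hyperplane orthogonal to [w]. Since [0^-1 = 0], it is the identity for
    [w = 0], so it stays an involution without a side condition. *)
Definition householder n (w : 'cV[R]_n) : 'M[R]_n :=
  1%:M - (2 / inner w w) *: (w *m w^T).

Lemma householder_sym n (w : 'cV[R]_n) : (householder w)^T = householder w.
Proof. by rewrite linearB linearZ /= trmx1 trmx_mul trmxK. Qed.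

Lemma householder_mul n (w : 'cV[R]_n) p (u : 'M[R]_(n, p)) :
  householder w *m u = u - (2 / inner w w) *: (w *m (w^T *m u)).
Proof. by rewrite mulmxBl mul1mx -scalemxAl mulmxA. Qed.

Lemma householder_vec n (w u : 'cV[R]_n) :
  householder w *m u = u - (2 / inner w w * inner w u) *: w.
Proof.
rewrite householder_mul (mx11_scalar (w^T *m u)) mul_mx_scalar scalerA.
by rewrite -trace_mx11.
Qed.

Lemma householderK n (w : 'cV[R]_n) : householder w *m householder w = 1%:M.
Proof.
have [w0|w0] := eqVneq (inner w w) 0.
  by rewrite /householder w0 invr0 mulr0 scale0r subr0 mulmx1.
rewrite {2}/householder mulmxBr mulmx1 -scalemxAr mulmxA householder_vec.
rewrite mulfVK// scaler_nat mulr2n opprD addrA subrr add0r mulNmx scalerN opprK.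
by rewrite subrK.
Qed.

Lemma householder_swap n (u v : 'cV[R]_n) : inner u u = inner v v ->
  householder (u - v) *m u = v.
Proof.
move=> uv; have [w0|w0] := eqVneq (inner (u - v) (u - v)) 0.
  rewrite householder_vec w0 invr0 mulr0 mul0r scale0r subr0.
  by apply/subr0_eq/inner_eq0.
rewrite householder_vec.
have -> : 2 / inner (u - v) (u - v) * inner (u - v) u = 1.
  apply: (mulfI w0); rewrite mulr1 mulrA mulrCA mulfV// mulr1.
  by rewrite !innerBl !innerBr -uv (innerC v u); ring.
by rewrite scale1r opprB addrC subrK.
Qed.

(** Over the complex numbers [A] is Hermitian, hence unitarily diagonalizable with real spectrum; a
    real root of the complexified characteristic polynomial is already a root over [R]. *)
Lemma sym_eigenvalue n (A : 'M[R]_n.+1) : A^T = A -> exists a, eigenvalue A a.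
Proof.
move=> sA; pose C : numClosedFieldType := complex R.
pose f : {rmorphism R -> C} := real_complex R.
pose B : 'M[C]_n.+1 := map_mx f A.
have hB : B \is hermsymmx.
  apply: realsym_hermsym; last first.
    apply/mxOverP => i j; rewrite mxE; apply/complex_realP.
    by exists (A i j).
  by apply/is_hermitianmxP; rewrite expr0 scale1r map_mx_id// map_trmx sA.
have dR := hermitian_spectral_diag_real hB.
have /orthomx_spectralP hS := hermitian_normalmx hB.
set P := spectralmx B in hS.
set s := spectral_diag B in hS dR.
have uP : P \in unitmx by exact: spectral_unit.
have eB : eigenvalue B (s 0 0).
  apply/eigenvalueP; exists (row 0 P); last first.
    apply/eqP => r0; have /row_freeP[Q hQ] : row_free P by rewrite row_free_unit.
    have /matrixP/(_ 0 0) := congr1 (row 0) hQ.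
    by rewrite row_mul r0 mul0mx row1 !mxE eqxx => /eqP; rewrite eq_sym oner_eq0.
  rewrite -row_mul {1}hS -/P -/s !mulmxA mulmxV// mul1mx.
  by rewrite row_mul row_diag_mx -scalemxAl -rowE.
have /complex_realP[a ha] : s 0 0 \is Num.real.
  by have /mxOverP := dR; apply.
exists a; rewrite eigenvalue_root_char.
move: eB; rewrite eigenvalue_root_char ha -map_char_poly.
by rewrite (fmorph_root f).
Qed.

(* A Householder reflection sends a unit eigenvector to e_0 and splits it off. *)
Lemma sym_spectral n (A : 'M[R]_n) : A^T = A ->
  exists (P : 'M[R]_n) (d : 'rV[R]_n),
    P *m P^T = 1%:M /\ A = P^T *m diag_mx d *m P.
Proof.
elim: n A => [|n IHn] A sA.
  by exists 1%:M, 0; split; apply/matrixP => -[].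
have [a /eigenvalueP[u uA u0]] := sym_eigenvalue sA.
pose v : 'cV[R]_(1 + n) := (fnorm u)^-1 *: u^T.
have nu0 : fnorm u != 0 by apply: contra_neq u0; exact: fnorm_eq0.
have vv : inner v v = 1.
  rewrite innerZl innerZr inner_tr -sqr_fnorm expr2 mulrA -invfM mulVf//.
  by rewrite mulf_neq0.
have Av : A *m v = a *: v.
  by rewrite -scalemxAr -{1}sA -trmx_mul uA linearZ /= scalerA mulrC -scalerA.
pose e0 : 'cV[R]_(1 + n) := delta_mx 0 0.
have e00 : inner e0 e0 = 1.
  by rewrite /inner trace_mx11 trmx_delta -rowE !mxE !eqxx.
pose H := householder (v - e0).
have sH : H^T = H := householder_sym _.
have HH : H *m H = 1%:M := householderK _.
have Hv : H *m v = e0 by rewrite householder_swap// vv e00.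
have He0 : H *m e0 = v by rewrite -Hv mulmxA HH mul1mx.
pose B : 'M[R]_(1 + n) := H *m A *m H.
have defB : B = H *m A *m H by [].
have sB : B^T = B by rewrite !trmx_mul sH sA mulmxA.
have Be0 : B *m e0 = a *: e0 by rewrite -!mulmxA He0 Av -scalemxAr Hv.
clearbody B.
have B0 i : B i 0 = a * (i == 0)%:R.
  by have /matrixP/(_ i 0) := Be0; rewrite -colE !mxE eqxx andbT.
have [|P' [d' [PP' B'E]]] := IHn (drsubmx B); first by rewrite trmx_drsub sB.
pose P1 : 'M[R]_(1 + n) := block_mx 1%:M 0 0 P'.
have BE : B = P1^T *m diag_mx (row_mx a%:M d') *m P1.
  rewrite /P1 tr_block_mx diag_mx_row !mulmx_block !trmx0 trmx1.
  rewrite !(mul0mx, mulmx0, addr0, add0r, mul1mx, mulmx1) -B'E.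
  rewrite -[LHS]submxK; congr block_mx.
  - by apply/matrixP => i j; rewrite !ord1 !mxE !lshift0 B0 mulr1.
  - apply/matrixP => i j; rewrite !mxE -[in LHS]sB mxE !ord1 lshift0 B0.
    by rewrite mulr0.
  - apply/matrixP => i j; rewrite !mxE !ord1 lshift0 B0.
    by rewrite mulr0.
have P1P1 : P1 *m P1^T = 1%:M.
  rewrite /P1 tr_block_mx mulmx_block !trmx0 trmx1.
  by rewrite !(mul0mx, mulmx0, addr0, add0r, mul1mx, mulmx1) PP' -scalar_mx_block.
exists (P1 *m H), (row_mx a%:M d'); split.
  by rewrite trmx_mul sH mulmxA -(mulmxA P1) HH mulmx1.
rewrite trmx_mul sH -!mulmxA (mulmxA _ P1) (mulmxA P1^T) (mulmxA _ _ P1) -BE.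
by rewrite defB !mulmxA HH mul1mx -mulmxA HH mulmx1.
Qed.

End Spectral.

(** * Ordered eigenvalues of a diagonalized matrix *)

Section OrderedEigenvalues.
Context {R : realType}.

Lemma char_poly_conj n (P A : 'M[R]_n) :
  P *m P^T = 1%:M -> char_poly (P^T *m A *m P) = char_poly A.
Proof.
move=> PP; have PP' : P^T *m P = 1%:M by apply: mulmx1C.
have cm (B C : 'M[R]_n) : map_mx polyC (B *m C) = map_mx polyC B *m map_mx polyC C.
  exact: map_mxM.
rewrite /char_poly /char_poly_mx.
set p : 'M[R]_n -> 'M[{poly R}]_n := map_mx polyC in cm *.
have p1 : p P^T *m p P = 1%:M by rewrite -cm PP' /p map_mx1.
have -> : 'X%:M - p (P^T *m A *m P) = p P^T *m ('X%:M - p A) *m p P.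
  by rewrite mulmxBr mulmxBl !cm scalar_mxC -(mulmxA 'X%:M) p1 mulmx1.
by rewrite !det_mulmx mulrAC -det_mulmx p1 det1 mul1r.
Qed.

Lemma char_poly_diag n (d : 'rV[R]_n) :
  char_poly (diag_mx d) = \prod_(a <- [seq d 0 i | i : 'I_n]) ('X - a%:P).
Proof.
rewrite char_poly_trig ?diag_mx_is_trig// big_map enumT.
by apply: eq_bigr => i _; rewrite mxE eqxx mulr1n.
Qed.

(** The sorted diagonal shows that [xget] has a candidate, and unique factorization into linear
    factors makes whatever it picks a permutation of the diagonal. *)
Lemma eigvals_spec n (P : 'M[R]_n) (d : 'rV[R]_n) : P *m P^T = 1%:M ->
  sorted >=%R (eigvals (P^T *m diag_mx d *m P)) /\
  perm_eq (eigvals (P^T *m diag_mx d *m P)) [seq d 0 i | i : 'I_n].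
Proof.
move=> PP; set A := _ *m P.
have cA : char_poly A = \prod_(a <- [seq d 0 i | i : 'I_n]) ('X - a%:P).
  by rewrite char_poly_conj// char_poly_diag.
have [|h1 h2] := @xgetPex _ [::] [set s : seq R | sorted >=%R s /\
    char_poly A = \prod_(a <- s) ('X - a%:P)].
  exists (sort >=%R [seq d 0 i | i : 'I_n]); split.
    exact/sort_sorted/ge_total.
  by rewrite cA; apply: perm_big; rewrite perm_sym perm_sort.
by split=> //; apply: prod_XsubC_eq; rewrite -h2.
Qed.

(** Counts are invariant under permutation, so the second eigenvalue can be compared with an
    unsorted diagonal: at most one entry exceeds it, and at least two reach it. *)
Lemma count_gt_second (s : seq R) :
  sorted >=%R s -> (count (fun a => (nth 0 s 1 < a)%R) s <= 1)%N.
Proof.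
case: s => [|a [|b s]] //=; first by case: ltP.
move=> /andP[_ h].
rewrite ltxx add0n (_ : count _ s = 0)%N; first by case: ltP.
apply/eqP; rewrite eqn0Ngt -has_count; apply/hasPn => c cs /=; rewrite -leNgt.
have /allP := order_path_min (rev_trans le_trans) h.
exact.
Qed.

Lemma count_ge_second (s : seq R) : sorted >=%R s -> (1 < size s)%N ->
  (1 < count (fun a => (nth 0 s 1 <= a)%R) s)%N.
Proof. by case: s => [|a [|b s]] //= /andP[-> _] _; rewrite lexx. Qed.

Lemma last_sorted_le (s : seq R) x :
  sorted >=%R s -> x \in s -> nth 0 s (size s).-1 <= x.
Proof.
move=> sS xs; have sz : (0 < size s)%N by case: s xs {sS}.
rewrite -(nth_index 0 xs).
apply: (sorted_leq_nth (rev_trans le_trans) (@lexx _ R) 0 sS).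
- by rewrite inE index_mem.
- by rewrite inE prednK.
- by rewrite -ltnS prednK// index_mem.
Qed.

Lemma count_codom n (d : 'I_n -> R) (p : pred R) :
  count p [seq d i | i : 'I_n] = #|[pred i | p (d i)]|.
Proof. by rewrite count_map cardE -size_filter /enum_mem -enumT filter_predT. Qed.

Variables (n : nat) (P : 'M[R]_n) (d : 'rV[R]_n).
Hypothesis PP : P *m P^T = 1%:M.
Let A := P^T *m diag_mx d *m P.

Lemma nth_eigval2_ge i j : i != j ->
  d 0 i <= nth_eigval 2 A \/ d 0 j <= nth_eigval 2 A.
Proof.
have [sS sP] := eigvals_spec d PP; rewrite -/A in sS sP.
move=> ij; apply/orP; apply: contraTT (count_gt_second sS).
rewrite negb_or -!ltNge (permP sP) count_codom => /andP[h1 h2].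
by rewrite -ltnNge; apply/card_gt1P; exists i, j; rewrite !inE.
Qed.

Lemma nth_eigval2_ex i : (1 < n)%N ->
  exists2 j, j != i & nth_eigval 2 A <= d 0 j.
Proof.
have [sS sP] := eigvals_spec d PP; rewrite -/A in sS sP => n1.
have := count_ge_second sS; rewrite (perm_size sP) size_codom card_ord.
move/(_ n1); rewrite (permP sP) count_codom => /card_gt1P[j [k []]].
rewrite !inE => hj hk jk; have [ji|ji] := eqVneq j i; last by exists j.
by exists k => //; rewrite -ji eq_sym.
Qed.

Lemma nth_eigval_last_le i : nth_eigval n A <= d 0 i.
Proof.
have [sS sP] := eigvals_spec d PP; rewrite -/A in sS sP.
have -> : nth_eigval n A = nth 0 (eigvals A) (size (eigvals A)).-1.
  by rewrite (perm_size sP) size_codom card_ord.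
by apply: last_sorted_le => //; rewrite (perm_mem sP); apply: codom_f.
Qed.

Lemma nth_eigval_last_ex : (0 < n)%N -> exists i, nth_eigval n A = d 0 i.
Proof.
have [_ sP] := eigvals_spec d PP; rewrite -/A in sP => n0.
have : nth_eigval n A \in [seq d 0 i | i : 'I_n].
  rewrite -(perm_mem sP) mem_nth// (perm_size sP) size_codom card_ord.
  by rewrite prednK.
by case/codomP => i hi; exists i.
Qed.

End OrderedEigenvalues.

(** * Quadratic forms and powers in an orthonormal eigenbasis *)

Section SpectralCalculus.
Context {R : realType} (n : nat) (P : 'M[R]_n).
Hypothesis PP : P *m P^T = 1%:M.

Lemma orthoK p (v : 'M[R]_(n, p)) : P^T *m (P *m v) = v.
Proof. by rewrite mulmxA (mulmx1C PP) mul1mx. Qed.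

Lemma inner_ortho p (u v : 'M[R]_(n, p)) : inner (P *m u) (P *m v) = inner u v.
Proof. by rewrite inner_mull orthoK. Qed.

Lemma spectral_exp (d : 'rV[R]_n) t :
  (P^T *m diag_mx d *m P) ^+ t = P^T *m diag_mx (\row_i d 0 i ^+ t) *m P.
Proof.
elim: t => [|t IHt].
  rewrite expr0 (_ : \row_i _ = const_mx 1); last by apply/rowP => i; rewrite !mxE.
  by rewrite diag_const_mx mulmx1 (mulmx1C PP).
rewrite exprS IHt -mulmxE -!mulmxA (mulmxA P) PP mul1mx (mulmxA (diag_mx d)).
congr (_ *m (_ *m _)); rewrite mulmx_diag; congr diag_mx.
by apply/rowP => i; rewrite !mxE exprS.
Qed.

Lemma inner_diag (f g : 'rV[R]_n) (u : 'cV[R]_n) :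
  inner (diag_mx f *m u) (diag_mx g *m u) = \sum_i f 0 i * g 0 i * u i 0 ^+ 2.
Proof.
rewrite innerE; apply: eq_bigr => i _; rewrite big_ord1 !mul_diag_mx !mxE.
by rewrite expr2 mulrACA.
Qed.

Lemma inner_spectral (f g : 'rV[R]_n) (v : 'cV[R]_n) :
  inner (P^T *m diag_mx f *m P *m v) (P^T *m diag_mx g *m P *m v) =
  \sum_i f 0 i * g 0 i * (P *m v) i 0 ^+ 2.
Proof.
rewrite -!(mulmxA _ P) -!(mulmxA P^T) -inner_ortho !(mulmxA P) PP !mul1mx.
exact: inner_diag.
Qed.

Lemma spectral1 : P^T *m diag_mx (const_mx 1) *m P = 1%:M.
Proof. by rewrite diag_const_mx mulmx1 (mulmx1C PP). Qed.

Lemma inner_spectral1 (g : 'rV[R]_n) (v : 'cV[R]_n) :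
  inner v (P^T *m diag_mx g *m P *m v) = \sum_i g 0 i * (P *m v) i 0 ^+ 2.
Proof.
rewrite -{1}[v]mul1mx -spectral1 inner_spectral.
by under eq_bigr do rewrite mxE mul1r.
Qed.

End SpectralCalculus.

(** * Powers of the communication matrix *)

Section CommunicationSpectrum.
Context {R : realType} (N : nat) (e : rel 'I_N) (W : 'M[R]_N).
Hypotheses (N_ge2 : (2 <= N)%N) (hW : communication_matrix e W).

Let sigma := nth_singval 2 W.

Lemma comm_mul1 : W *m const_mx 1 = const_mx 1 :> 'cV_N.
Proof.
apply/colP => i; rewrite !mxE -[RHS](comm_row_sum hW i).
by apply: eq_bigr => j _; rewrite mxE mulr1.
Qed.

Lemma commX_mul1 t : W ^+ t *m const_mx 1 = const_mx 1 :> 'cV_N.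
Proof.
elim: t => [|t IHt]; first by rewrite expr0 mul1mx.
by rewrite exprSr -mulmxE -mulmxA comm_mul1.
Qed.

Lemma commX_row_sum t i : \sum_j (W ^+ t) i j = 1.
Proof.
have /colP/(_ i) := commX_mul1 t; rewrite !mxE => <-.
by apply: eq_bigr => j _; rewrite mxE mulr1.
Qed.

Lemma commX_sym t i j : (W ^+ t) i j = (W ^+ t) j i.
Proof.
have -> : (W ^+ t) i j = (W ^+ t)^T j i by rewrite mxE.
congr (fun_of_matrix _ _ _); elim: t => [|t IHt]; first by rewrite expr0 trmx1.
by rewrite exprS -mulmxE trmx_mul IHt (comm_sym hW) !mulmxE -exprSr exprS.
Qed.

Lemma commX_col_sum t j : \sum_i (W ^+ t) i j = 1.
Proof. by rewrite -(commX_row_sum t j); apply: eq_bigr => i _; rewrite commX_sym. Qed.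

Lemma commX_ge0 t i j : 0 <= (W ^+ t) i j.
Proof.
elim: t i j => [|t IHt] i j; first by rewrite expr0 mxE ler0n.
rewrite exprS -mulmxE mxE; apply: sumr_ge0 => k _.
by rewrite mulr_ge0// (comm_ge0 hW).
Qed.

(* [i0] indexes the consensus direction: since sigma < 1, the eigenvalue 1 is
   simple, with eigenvector proportional to the all-ones vector. *)
Lemma comm_spectrum : exists (P : 'M[R]_N) (d : 'rV[R]_N) (i0 : 'I_N),
  [/\ P *m P^T = 1%:M, W = P^T *m diag_mx d *m P, d 0 i0 = 1,
      forall j, j != i0 -> d 0 j ^+ 2 <= sigma ^+ 2 &
      forall j, j != i0 -> (P *m (const_mx 1 : 'cV_N)) j 0 = 0].
Proof.
have [P [d [PP WE]]] := sym_spectral (comm_sym hW).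
have W2E : W^T *m W = P^T *m diag_mx (\row_i d 0 i ^+ 2) *m P.
  by rewrite (comm_sym hW) mulmxE -expr2 WE spectral_exp.
set c := P *m (const_mx 1 : 'cV_N).
(* The all-ones vector is fixed by [W], so its coordinates live on eigenvalues equal to 1. *)
have dc j : d 0 j * c j 0 = c j 0.
  have : diag_mx d *m c = c.
    rewrite /c -{2}comm_mul1 WE !mulmxA PP mul1mx.
    by rewrite -!mulmxA.
  by move=> /colP/(_ j); rewrite mul_diag_mx mxE.
have [i0 ci0] : exists i, c i 0 != 0.
  apply/existsP; apply: contraT; rewrite negb_exists => /forallP c0.
  have c0' : c = 0.
    by apply/colP => i; rewrite [in RHS]mxE; apply/eqP; have := c0 i; rewrite negbK.
  have /colP/(_ (Ordinal (ltnW N_ge2))) := orthoK PP (const_mx 1 : 'cV[R]_N).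
  by rewrite -/c c0' mulmx0 !mxE => /eqP; rewrite eq_sym oner_eq0.
have d1 : d 0 i0 = 1 by apply: (mulIf ci0); rewrite mul1r.
have s0 : 0 <= sigma by case/andP: (comm_singval hW).
have s1 : sigma < 1 by case/andP: (comm_singval hW).
have dj j : j != i0 -> d 0 j ^+ 2 <= sigma ^+ 2.
  move=> ji; have := nth_eigval2_ge (\row_i d 0 i ^+ 2) PP ji.
  rewrite -W2E !mxE d1 expr1n; set l := nth_eigval 2 _.
  (* [Num.sqrt] sends negative numbers to 0, hence the side condition; each of the two lower bounds
     on [l] below supplies it. *)
  have lE : 0 <= l -> sigma ^+ 2 = l by move=> l0; rewrite sqr_sqrtr.
  case=> h.
    have l0 : 0 <= l by apply: le_trans h; exact: sqr_ge0.
    by rewrite lE.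
  have l0 : 0 <= l by apply: le_trans h; exact: ler01.
  by move: h; rewrite -(lE l0) leNgt expr_lt1// s1.
exists P, d, i0; split => // j ji; apply/eqP; apply: contraT => cj.
have dj1 : d 0 j = 1 by apply: (mulIf cj); rewrite mul1r.
by have := dj j ji; rewrite dj1 expr1n leNgt expr_lt1// s1.
Qed.

(** The last clause is orthogonality to consensus: in the eigenbasis the all-ones vector is
    supported at [i0], so a vector of zero sum has no component there. *)
Lemma comm_powers_spectrum t : exists (P : 'M[R]_N) (d : 'rV[R]_N) (i0 : 'I_N),
  [/\ P *m P^T = 1%:M, W ^+ t = P^T *m diag_mx d *m P, d 0 i0 = 1,
      forall j, j != i0 -> `|d 0 j| <= sigma ^+ t &
      forall v : 'cV_N, \sum_i v i 0 = 0 -> (P *m v) i0 0 = 0].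
Proof.
have [P [d [i0 [PP WE d1 dj c0]]]] := comm_spectrum.
have s0 : 0 <= sigma by case/andP: (comm_singval hW).
exists P, (\row_i d 0 i ^+ t), i0; split => //.
- by rewrite WE spectral_exp.
- by rewrite mxE d1 expr1n.
- move=> j ji; rewrite mxE normrX lerXn2r// ?nnegrE//.
  by apply: ler_sq => //; rewrite real_normK ?num_real ?dj.
move=> v v0; pose c := P *m (const_mx 1 : 'cV_N).
have ci0 : c i0 0 != 0.
  apply: contraT; rewrite negbK => /eqP ci0.
  have c0' : c = 0.
    by apply/colP => i; rewrite [in RHS]mxE; have [->//|/c0] := eqVneq i i0.
  have /colP/(_ i0) := orthoK PP (const_mx 1 : 'cV[R]_N).
  by rewrite -/c c0' mulmx0 !mxE => /eqP; rewrite eq_sym oner_eq0.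
have : inner c (P *m v) = 0.
  rewrite inner_ortho// innerE -[RHS]v0; apply: eq_bigr => i _.
  by rewrite big_ord1 mxE mul1r.
rewrite innerE; under eq_bigr do rewrite big_ord1.
rewrite (bigD1 i0)//= big1 => [|i ii0]; last by rewrite c0 ?mul0r.
by rewrite addr0 => /eqP; rewrite mulf_eq0 (negPf ci0) /= => /eqP.
Qed.

Variable t : nat.
Hypothesis t_ge1 : (1 <= t)%N.

Lemma sigmaX_lt1 : sigma ^+ t < 1.
Proof. by have /andP[s0 s1] := comm_singval hW; rewrite exprn_ilt1// -lt0n. Qed.

Lemma sigmaX_ge0 : 0 <= sigma ^+ t.
Proof. by have /andP[s0 s1] := comm_singval hW; rewrite exprn_ge0. Qed.

Lemma mu_gt0 : 0 < mu W t.
Proof.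
have [P [d [i0 [PP WE d1 dj _]]]] := comm_powers_spectrum t.
have [j ji] := nth_eigval2_ex d PP i0 N_ge2.
rewrite /mu subr_gt0 WE => /le_lt_trans; apply.
by rewrite (le_lt_trans (ler_norm _))// (le_lt_trans (dj _ ji)) ?sigmaX_lt1.
Qed.

Lemma Lip_le2 : Lip W t <= 2.
Proof.
have [P [d [i0 [PP WE d1 dj _]]]] := comm_powers_spectrum t.
have [i hi] := nth_eigval_last_ex d PP (ltnW N_ge2).
rewrite /Lip WE hi; have [->|ii0] := eqVneq i i0; first by rewrite d1; lra.
have := dj _ ii0; have := sigmaX_lt1; rewrite ler_norml => h /andP[+ _]; lra.
Qed.

Lemma Lip_ge0 : 0 <= Lip W t.
Proof.
have [P [d [i0 [PP WE d1 _ _]]]] := comm_powers_spectrum t.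
by rewrite subr_ge0 WE -d1 nth_eigval_last_le.
Qed.

Lemma laplacian_ge (v : 'cV[R]_N) : \sum_i v i 0 = 0 ->
  mu W t * inner v v <= inner v (v - W ^+ t *m v).
Proof.
have [P [d [i0 [PP WE d1 dj h]]]] := comm_powers_spectrum t => /h u0.
(* The alternative, that the entry 1 at [i0] is at most the second eigenvalue, contradicts
   [mu_gt0]. *)
have m j : j != i0 -> d 0 j <= nth_eigval 2 (W ^+ t).
  move=> ji; rewrite WE.
  have [//|] := nth_eigval2_ge d PP ji; rewrite d1 -WE => h1.
  by have := mu_gt0; rewrite /mu; lra.
rewrite innerBr WE inner_spectral1// -(inner_ortho PP v v) innerE.
rewrite mulr_sumr -sumrB; apply: ler_sum => i _; rewrite big_ord1 -expr2.
have [->|ii0] := eqVneq i i0; first by rewrite u0 expr0n /= !mulr0 subrr.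
rewrite -[X in _ <= X - _]mul1r -mulrBl ler_wpM2r ?sqr_ge0// /mu.
by rewrite lerD2l lerN2 m.
Qed.

Lemma laplacian_le (v : 'cV[R]_N) :
  inner v (v - W ^+ t *m v) <= Lip W t * inner v v.
Proof.
have [P [d [i0 [PP WE _ _ _]]]] := comm_powers_spectrum t.
rewrite innerBr WE inner_spectral1// -(inner_ortho PP v v) innerE.
rewrite mulr_sumr -sumrB; apply: ler_sum => i _; rewrite big_ord1 -expr2.
rewrite -[X in X - _ <= _]mul1r -mulrBl ler_wpM2r ?sqr_ge0// /Lip.
by rewrite lerD2l lerN2 WE nth_eigval_last_le.
Qed.

(** In each eigendirection (1 - d)^2 <= L (1 - d), because 0 <= 1 - d <= L. *)
Lemma laplacian_sq_le (v : 'cV[R]_N) :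
  inner (v - W ^+ t *m v) (v - W ^+ t *m v) <=
  Lip W t * inner v (v - W ^+ t *m v).
Proof.
have [P [d [i0 [PP WE d1 dj _]]]] := comm_powers_spectrum t.
rewrite innerBl !innerBr (innerC _ v) WE inner_spectral// inner_spectral1//.
rewrite -(inner_ortho PP v v) innerE -!sumrB mulr_sumr.
apply: ler_sum => i _; rewrite big_ord1 -expr2; set u := _ ^+ 2.
have -> : u - d 0 i * u - (d 0 i * u - d 0 i * d 0 i * u) =
  (1 - d 0 i) * ((1 - d 0 i) * u) by ring.
have -> : u - d 0 i * u = (1 - d 0 i) * u by ring.
have d1' : d 0 i <= 1.
  have [->|/dj] := eqVneq i i0; first by rewrite d1.
  by have := sigmaX_lt1; rewrite ler_norml => h /andP[_]; lra.
apply: ler_wpM2r; first by rewrite mulr_ge0 ?subr_ge0 ?sqr_ge0.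
rewrite /Lip lerD2l lerN2 WE.
exact: nth_eigval_last_le.
Qed.

(** The row minus 1/N is the image under [W ^+ t] of e_i minus its average. That vector has zero sum
    and norm at most 1, so it contracts by [sigma ^+ t]. *)
Lemma comm_row_dist i :
  \sum_j ((W ^+ t) i j - N%:R^-1) ^+ 2 <= (sigma ^+ t) ^+ 2.
Proof.
have [P [d [i0 [PP WE d1 dj h]]]] := comm_powers_spectrum t.
have N0 : N%:R != 0 :> R by rewrite pnatr_eq0 -lt0n ltnW.
pose v : 'cV[R]_N := delta_mx i 0 - const_mx N%:R^-1.
have sv : \sum_k v k 0 = 0.
  under eq_bigr do rewrite !mxE eqxx andbT.
  rewrite sumrB sumr_const card_ord -[X in _ - X]mulr_natl mulfV// (bigD1 i)//= eqxx.
  by rewrite big1 ?addr0 ?subrr// => k /negPf ->.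
have vv : inner v v <= 1.
  have -> : inner v v = inner v (delta_mx i 0).
    rewrite {2}/v innerBr; have -> : inner v (const_mx N%:R^-1) = 0.
      rewrite -(mul0r N%:R^-1) -sv mulr_suml innerE.
      by apply: eq_bigr => k _; rewrite big_ord1 [in X in _ * X]mxE.
    by rewrite subr0.
  rewrite innerC /inner trace_mx11 trmx_delta -rowE !mxE !eqxx /=.
  by rewrite lerBlDr lerDl invr_ge0 ler0n.
have -> : \sum_j ((W ^+ t) i j - N%:R^-1) ^+ 2 = inner (W ^+ t *m v) (W ^+ t *m v).
  rewrite innerE; apply: eq_bigr => j _; rewrite big_ord1 -expr2; congr (_ ^+ 2).
  rewrite mulmxBr -colE (_ : const_mx _ = N%:R^-1 *: const_mx 1); last first.
    by apply/colP => k; rewrite !mxE mulr1.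
  by rewrite -scalemxAr commX_mul1 !mxE mulr1 commX_sym.
rewrite WE inner_spectral// -(mulr1 (_ ^+ 2)).
apply: (@le_trans _ _ ((sigma ^+ t) ^+ 2 * inner v v)); last first.
  by rewrite ler_wpM2l ?sqr_ge0.
rewrite -(inner_ortho PP v v) innerE mulr_sumr; apply: ler_sum => j _.
rewrite big_ord1 -expr2 -expr2; have [->|ji] := eqVneq j i0.
  by rewrite h// expr0n /= !mulr0.
rewrite ler_wpM2r ?sqr_ge0// -(real_normK (num_real (d 0 j))).
by rewrite lerXn2r ?nnegrE ?sigmaX_ge0 ?dj.
Qed.

Lemma enough_rounds_sigma : enough_rounds W t -> sigma ^+ t <= 1 / (2 * Num.sqrt N%:R).
Proof.
have N0 : 0 < Num.sqrt N%:R :> R by rewrite sqrtr_gt0 ltr0n ltnW.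
rewrite /enough_rounds -/sigma; have [->|s0] := eqVneq sigma 0.
  by move=> _; rewrite expr0n eqn0Ngt t_ge1 /= divr_ge0// mulr_ge0// ltW.
have /andP[s0' s1] := comm_singval hW; rewrite -/sigma in s0' s1.
have sp : 0 < sigma by rewrite lt_def s0.
have lns : ln sigma < 0 by rewrite ln_lt0 ?sp.
rewrite ceil_le_int -[t%:Z%:~R]/(t%:R : R) ler_ndivrMr// (mulr_natl (ln sigma)) => h.
have q0 : 0 < 1 / (2 * Num.sqrt N%:R) :> R by rewrite divr_gt0// mulr_gt0.
by rewrite -ler_ln ?posrE ?exprn_gt0// lnXn.
Qed.

End CommunicationSpectrum.

(** * Induced arithmetic mean and polar retraction *)

Section StiefelGeometry.
Context {R : realType}.

Lemma stiefel_inner_mul d r (x : 'M[R]_(d, r)) p (A B : 'M[R]_(r, p)) :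
  stiefel x -> inner (x *m A) (x *m B) = inner A B.
Proof. by move=> sx; rewrite inner_mull mulmxA sx mul1mx. Qed.

Lemma stiefel_fnorm_mul d r (x : 'M[R]_(d, r)) p (A : 'M[R]_(r, p)) :
  stiefel x -> fnorm (x *m A) = fnorm A.
Proof. by move=> sx; rewrite /fnorm stiefel_inner_mul. Qed.

(** The quadratic form z -> <z C, z> is constant on the manifold, equal to tr C; expanding it at x -
    y makes normal directions x C pair to second order. *)
Lemma stiefel_inner_sym d r (x y : 'M[R]_(d, r)) (C : 'M[R]_r) :
  stiefel x -> stiefel y -> C^T = C ->
  inner (x *m C) (x - y) = 2^-1 * inner ((x - y) *m C) (x - y).
Proof.
move=> sx sy sC.
have tE (z : 'M[R]_(d, r)) : stiefel z -> inner (z *m C) z = \tr C.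
  by move=> sz; rewrite -{2}[z]mulmx1 stiefel_inner_mul// innerC inner1l.
rewrite mulmxBl !innerBr !innerBl !tE// [inner (y *m C) x]inner_mulr sC innerC.
by rewrite (innerC y); lra.
Qed.

(** First-order optimality without derivatives: h = k c with k |b| < 1 already forces c^2 <= 0. *)
Lemma eq0_of_le_square (b c : R) : (forall h, h * c <= h ^+ 2 * b) -> c = 0.
Proof.
move=> h; pose k := (`|b| + 1)^-1.
have b0 : 0 < `|b| + 1 by rewrite ltr_wpDl.
have k0 : 0 < k by rewrite invr_gt0.
have kb : k * b < 1.
  by rewrite -(mulVf (lt0r_neq0 b0)) ltr_pM2l// (le_lt_trans (ler_norm b))// ltrDl.
have : (k * (1 - k * b)) * c ^+ 2 <= 0 by have := h (k * c); nra.
rewrite pmulr_rle0 ?mulr_gt0 ?subr_gt0// => c2.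
by apply/eqP; rewrite -sqrf_eq0 eq_le c2 sqr_ge0.
Qed.

Lemma householder_trace n (v : 'cV[R]_n) (A : 'M[R]_n) :
  \tr (householder v *m A) = \tr A - 2 / inner v v * inner v (A *m v).
Proof.
rewrite householder_mul linearB linearZ /=; congr (_ - _ * _).
by rewrite mxtrace_mulC /inner mulmxA.
Qed.

(* Testing with reflections gives positivity; products of two reflections, i.e.
   plane rotations, give symmetry. *)
Lemma trace_max_psd n (A : 'M[R]_n) :
  (forall Q, Q^T *m Q = 1%:M -> \tr (Q *m A) <= \tr A) -> psd A.
Proof.
move=> h; apply/psdP; split=> [|v]; last first.
  have [v0|v0] := eqVneq (inner v v) 0.
    by rewrite (inner_eq0 v0) mulmx0 inner0r.
  have vp : 0 < inner v v by rewrite lt_def v0 inner_ge0.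
  have := h (householder v); rewrite householder_sym householderK householder_trace.
  by move=> /(_ erefl); rewrite gerBl pmulr_rge0// divr_gt0.
have eE (k l : 'I_n) : inner (delta_mx k 0 : 'cV_n) (A *m delta_mx l 0) = A k l.
  by rewrite -colE /inner trace_mx11 trmx_delta -rowE !mxE.
have e1 (k l : 'I_n) : inner (delta_mx k 0 : 'cV[R]_n) (delta_mx l 0) = (k == l)%:R.
  by rewrite -[delta_mx l 0]mul1mx /inner trace_mx11 trmx_delta -colE -rowE !mxE.
apply/matrixP => i j; rewrite mxE; have [->//|ij] := eqVneq i j.
apply/subr0_eq/(@eq0_of_le_square (A i i + A j j)) => k.
(* The two reflections compose to a rotation by an angle of order k in the plane of e_i and e_j;
   optimality then reads k (A_ji - A_ij) <= k^2 (A_ii + A_jj). *)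
pose u : 'cV[R]_n := delta_mx i 0; pose v : 'cV[R]_n := u + k *: delta_mx j 0.
have := h (householder u *m householder v).
have -> : (householder u *m householder v)^T *m (householder u *m householder v) = 1%:M.
  rewrite trmx_mul !householder_sym mulmxA -[_ *m _ *m householder u]mulmxA.
  by rewrite householderK mulmx1 householderK.
move=> /(_ erefl); rewrite -mulmxA householder_trace householder_trace.
rewrite -(mulmxA (householder v)) householder_vec innerBr innerZr.
have vv : inner v v = 1 + k ^+ 2.
  rewrite /v innerDl !innerDr !innerZl !innerZr !e1 !eqxx.
  rewrite (negPf ij) [j == i]eq_sym (negPf ij) /=.
  by ring.
have uv : inner u v = 1 by rewrite innerDr innerZr !e1 eqxx (negPf ij) /=; ring.
have uu : inner u u = 1 by rewrite e1 eqxx.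
have uAu : inner u (A *m u) = A i i by rewrite eE.
have vAu : inner v (A *m u) = A i i + k * A j i by rewrite innerDl innerZl !eE.
have vAv : inner v (A *m v) = A i i + k * (A i j + A j i) + k ^+ 2 * A j j.
  by rewrite /v mulmxDr -scalemxAr innerDl !innerDr !innerZl !innerZr !eE; ring.
rewrite uv uu uAu vAu vAv vv => {}h.
have k1 : 0 < 1 + k ^+ 2 by rewrite ltr_wpDr ?sqr_ge0.
set p := 1 + k ^+ 2 in h k1 *.
have q : 0 <= (2 / p) * (p * A i i + (A i i + k * (A i j + A j i) + k ^+ 2 * A j j)
   - 2 * (A i i + k * A j i)).
  move: h; rewrite -subr_ge0; congr (_ <= _); rewrite divr1; field.
  exact: lt0r_neq0.
by move: q; rewrite pmulr_rge0 ?divr_gt0// /p; lra.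
Qed.

Lemma psd1B_inner_le d r (D : 'M[R]_(d, r)) (S : 'M[R]_r) : psd (1%:M - S) ->
  (1 - \tr (1%:M - S)) * inner D D <= inner (D *m S) D.
Proof.
move=> hS; have := psd_inner_mulr_ge0 D (psd_tr_sub hS); set c := \tr _.
rewrite mulmxBr mul_mx_scalar mulmxBr mulmx1 !innerBl innerZl; lra.
Qed.

Definition mean N d r (x : 'I_N -> 'M[R]_(d, r)) : 'M[R]_(d, r) :=
  N%:R^-1 *: \sum_i x i.

(** All points of the manifold have squared norm r, so minimizing the distances is maximizing <z,
    mean>. Testing z = Q^T y makes mean y^T symmetric and positive semidefinite, and S = y^T mean
    inherits both. S <= I holds because each y^T x_i has quadratic form at most |v|^2. *)
Lemma iam_polar N d r (x : 'I_N -> 'M[R]_(d, r)) y : (0 < N)%N ->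
  stiefelN x -> is_iam x y -> exists S : 'M[R]_r,
  [/\ psd S, psd (1%:M - S), mean x = y *m S &
      \tr (1%:M - S) = (\sum_i fnorm (x i - y) ^+ 2) / (2 * N%:R)].
Proof.
move=> N0 sx [sy ymin]; have Np : 0 < N%:R :> R by rewrite ltr0n.
have N0' : N%:R != 0 :> R by rewrite lt0r_neq0.
have innM z : inner z (mean x) = N%:R^-1 * \sum_i inner z (x i).
  by rewrite innerZr inner_sumr.
have stI (z : 'M[R]_(d, r)) : stiefel z -> inner z z = r%:R.
  by move=> sz; rewrite /inner sz mxtrace1.
have distE z : stiefel z ->
    \sum_i fnorm (z - x i) ^+ 2 = 2 * N%:R * (r%:R - inner z (mean x)).
  move=> sz; rewrite innM mulrBr mulrA mulfK ?mulf_neq0// mulr_sumr.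
  have -> : 2 * N%:R * r%:R = \sum_(i < N) (2 * r%:R) :> R.
    by rewrite sumr_const card_ord -[RHS]mulr_natl; ring.
  rewrite -sumrB; apply: eq_bigr => i _.
  rewrite sqr_fnorm innerBl !innerBr (innerC (x i) z) (stI z)// (stI (x i))//.
  by ring.
have ymax z : stiefel z -> inner z (mean x) <= inner y (mean x).
  move=> sz; have := ymin z sz; rewrite !distE// ler_pM2l ?mulr_gt0//.
  by rewrite lerD2l lerN2.
have psdA : psd (mean x *m y^T).
  apply: trace_max_psd => Q QQ.
  have QQ' : Q *m Q^T = 1%:M by apply: mulmx1C.
  have := ymax (Q^T *m y); rewrite /stiefel /= trmx_mul trmxK -mulmxA (mulmxA Q).
  rewrite QQ' mul1mx => /(_ sy); rewrite /inner trmx_mul trmxK -mulmxA mxtrace_mulC.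
  by rewrite -mulmxA (mxtrace_mulC y^T).
have [sA pA] := (psdP _).1 psdA; pose S := y^T *m mean x.
have xS : mean x = y *m S^T.
  by rewrite trmx_mul trmxK mulmxA -{1}[mean x]mulmx1 -sy mulmxA -sA trmx_mul trmxK.
have sS : S^T = S by rewrite {2}/S xS mulmxA sy mul1mx.
exists S; split.
- apply/psdP; split=> // v; have := pA (y *m v).
  by rewrite -mulmxA (mulmxA y^T) sy mul1mx inner_mull /S -mulmxA.
- apply/psdP; split=> [|v]; first by rewrite linearB /= trmx1 sS.
  rewrite mulmxBl mul1mx innerBr subr_ge0 /S -mulmxA -inner_mull.
  rewrite /mean -scalemxAl innerZr ler_pdivrMl// mulmx_suml inner_sumr.
  rewrite mulr_natl -[X in _ *+ X]card_ord -sumr_const; apply: ler_sum => i _.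
  have := inner_ge0 (y *m v - x i *m v).
  rewrite innerBl !innerBr (innerC (x i *m v)) !stiefel_inner_mul//; lra.
- by rewrite xS sS.
rewrite linearB /= mxtrace1.
have -> : \tr S = inner y (mean x) by [].
have -> : \sum_i fnorm (x i - y) ^+ 2 = \sum_i fnorm (y - x i) ^+ 2.
  by apply: eq_bigr => i _; rewrite fnormC.
by rewrite distE// mulrAC mulfV ?mul1r// mulf_neq0.
Qed.

Lemma mean_iam_dist N d r (x : 'I_N -> 'M[R]_(d, r)) y : (0 < N)%N ->
  stiefelN x -> is_iam x y ->
  fnorm (mean x - y) <= (\sum_i fnorm (x i - y) ^+ 2) / (2 * N%:R).
Proof.
move=> N0 sx iy; have [S [_ pS -> <-]] := iam_polar N0 sx iy.
by rewrite fnormC -{1}[y]mulmx1 -mulmxBr (stiefel_fnorm_mul _ iy.1) psd_fnorm_le_tr.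
Qed.

(** Monotonicity: <y - y', y S - y' S'> is the average of the forms of S and S' at y - y', both at
    least 1 - c times |y - y'|^2; Cauchy-Schwarz concludes. *)
Lemma iam_lipschitz N d r (x x' : 'I_N -> 'M[R]_(d, r)) y y' (c : R) : (0 < N)%N ->
  stiefelN x -> stiefelN x' -> is_iam x y -> is_iam x' y' ->
  \sum_i fnorm (x i - y) ^+ 2 <= 2 * N%:R * c ->
  \sum_i fnorm (x' i - y') ^+ 2 <= 2 * N%:R * c ->
  (1 - c) * fnorm (y - y') <= fnorm (mean x - mean x').
Proof.
move=> N0 sx sx' iy iy'; have Np : 0 < 2 * N%:R :> R by rewrite mulr_gt0 ?ltr0n.
have [S [[sS _] pS -> tS]] := iam_polar N0 sx iy.
have [S' [[sS' _] pS' -> tS']] := iam_polar N0 sx' iy'.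
rewrite -!ler_pdivrMl// ![_^-1 * _]mulrC -tS -tS' => cS cS'.
have [y0|y0] := eqVneq (fnorm (y - y')) 0; first by rewrite y0 mulr0 fnorm_ge0.
rewrite -(ler_pM2l (_ : 0 < fnorm (y - y'))); last by rewrite lt_def y0 fnorm_ge0.
apply: le_trans (inner_CS _ _); rewrite innerC innerBl.
rewrite (stiefel_inner_sym iy.1 iy'.1 sS).
have -> : inner (y' *m S') (y - y') = - inner (y' *m S') (y' - y).
  by rewrite -innerNr opprB.
rewrite (stiefel_inner_sym iy'.1 iy.1 sS').
have := psd1B_inner_le (y - y') pS; have := psd1B_inner_le (y' - y) pS'.
have -> : inner (y' - y) (y' - y) = fnorm (y - y') ^+ 2 by rewrite fnormC sqr_fnorm.
rewrite -sqr_fnorm; set f := fnorm _; have f0 := sqr_ge0 f.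
by move: cS cS'; set a := \tr _; set b := \tr _; nra.
Qed.

(** Each eigenvalue d of [B] satisfies d >= 0 and d^2 >= 1, seen by testing at the eigenvectors P^T
    e_i. *)
Lemma psd_sub1 r (B K : 'M[R]_r) :
  psd B -> B *m B = 1%:M + K -> psd K -> psd (B - 1%:M) /\ B \in unitmx.
Proof.
move=> /psdP[sB pB] BB /psdP[sK pK].
have [P [d [PP BE]]] := sym_spectral sB.
have Pe i : P *m (P^T *m delta_mx i 0) = delta_mx i 0 :> 'cV_r.
  by rewrite mulmxA PP mul1mx.
have sumE (f : 'rV[R]_r) i :
    \sum_j f 0 j * (P *m (P^T *m delta_mx i 0 : 'cV_r)) j 0 ^+ 2 = f 0 i.
  rewrite Pe (bigD1 i)//= big1 => [|j ji]; first by rewrite mxE !eqxx expr1n mulr1 addr0.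
  by rewrite mxE (negPf ji) expr0n mulr0.
have d0 i : 0 <= d 0 i.
  by have := pB (P^T *m delta_mx i 0); rewrite BE inner_spectral1// sumE.
have d1 i : 1 <= d 0 i.
  have := pK (P^T *m delta_mx i 0).
  have -> : K = B *m B - 1%:M by rewrite BB addrC addKr.
  rewrite mulmxBl mul1mx innerBr -mulmxA -{1}sB -(inner_mull B) BE inner_spectral//.
  have -> : \sum_j d 0 j * d 0 j * (P *m (P^T *m delta_mx i 0 : 'cV_r)) j 0 ^+ 2 =
     d 0 i * d 0 i.
    have := sumE (\row_j (d 0 j * d 0 j)) i; rewrite mxE => <-.
    by apply: eq_bigr => j _; congr (_ * _); rewrite mxE.
  have -> : inner (P^T *m delta_mx i 0) (P^T *m delta_mx i 0 : 'cV_r) = 1.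
    rewrite inner_mull trmxK Pe innerE; under eq_bigr do rewrite big_ord1 !mxE eqxx andbT.
    rewrite (bigD1 i)//= eqxx big1 ?addr0 ?mulr1// => j /negPf ->.
    by rewrite mul0r.
  have := d0 i; move: (d 0 i) => a; nra.
split.
  apply/psdP; split=> [|v]; first by rewrite linearB /= trmx1 sB.
  rewrite mulmxBl mul1mx innerBr BE inner_spectral1// -(inner_ortho PP v v) innerE.
  rewrite -sumrB; apply: sumr_ge0 => i _; rewrite big_ord1 -expr2.
  by rewrite -[X in _ - X]mul1r -mulrBl mulr_ge0 ?sqr_ge0// subr_ge0.
have [uP uP'] := mulmx1_unit PP.
rewrite BE !unitmx_mul uP uP' /= andbT unitmxE det_diag unitfE.
by apply/prodf_neq0 => i _; rewrite lt0r_neq0// (lt_le_trans ltr01).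
Qed.

(* Membership of the retraction in the Stiefel manifold rules out the junk value
   [sqrtmx _ = 0], so the existence of the square root need not be proved. *)
Lemma polar_retr_decomp d r (x xi : 'M[R]_(d, r)) : (0 < r)%N ->
  stiefel (polar_retr x xi) ->
  exists2 C, psd C & x + xi = polar_retr x xi + polar_retr x xi *m C.
Proof.
move=> r0; rewrite /polar_retr /sqrtmx.
case: xgetP => [B _ [pB BB]|_] sz; last first.
  have : (0 : 'M[R]_r) = 1%:M.
    have [u0|u0] := boolP ((0 : 'M[R]_r) \in unitmx).
      by rewrite -(mulmxV u0) mul0mx.
    by rewrite -sz (invmx_out u0) !mulmx0.
  move/matrixP/(_ (Ordinal r0) (Ordinal r0)) => /eqP.
  by rewrite !mxE eqxx eq_sym oner_eq0.
have [pC uB] := psd_sub1 pB BB (psd_gram xi).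
by exists (B - 1%:M) => //; rewrite mulmxBr mulmx1 addrCA subrr addr0 mulmxKV.
Qed.

(** Write x + xi = z + z C with C positive semidefinite. In the expansion of |(z - y) + z C|^2 the
    cross term is the form of C at z - y, hence nonnegative. *)
Lemma polar_retr_le d r (x xi y : 'M[R]_(d, r)) : (0 < r)%N ->
  stiefel (polar_retr x xi) -> stiefel y ->
  fnorm (polar_retr x xi - y) <= fnorm (x + xi - y).
Proof.
move=> r0 sz sy; have [C pC ->] := polar_retr_decomp r0 sz.
set z := polar_retr x xi in sz *.
apply: ler_sq; rewrite ?fnorm_ge0// !sqr_fnorm.
have sC : C^T = C by case: pC.
have := stiefel_inner_sym sz sy sC; have := psd_inner_mulr_ge0 (z - y) pC.
rewrite addrAC; move: (z - y) => w; have := inner_ge0 (z *m C).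
rewrite innerDl !(innerDr _ w) (innerC w (z *m C)); lra.
Qed.

End StiefelGeometry.

(** * Consensus potential and one DRCS step *)

Section ConsensusPotential.
Context {R : realType} (d r N : nat) (e : rel 'I_N) (W : 'M[R]_N) (t : nat).
Hypotheses (r_ge1 : (1 <= r)%N) (N_ge2 : (2 <= N)%N).
Hypotheses (hW : communication_matrix e W) (t_ge1 : (1 <= t)%N).

Local Notation tuple := ('I_N -> 'M[R]_(d, r)).
Implicit Types (x : tuple) (y : 'M[R]_(d, r)).
Local Notation Wt := (W ^+ t).
Local Notation egrad := (egrad W t).
Local Notation rgrad := (rgrad W t).
Local Notation phi := (phi W t).
Local Notation L := (Lip W t).

Definition tuple_inner x x' := \sum_i inner (x i) (x' i).

Lemma sqr_tuple_fnorm x : tuple_fnorm x ^+ 2 = \sum_i fnorm (x i) ^+ 2.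
Proof. by rewrite sqr_sqrtr// sumr_ge0// => i _; rewrite sqr_ge0. Qed.

Lemma tuple_innerxx x : tuple_inner x x = tuple_fnorm x ^+ 2.
Proof. by rewrite sqr_tuple_fnorm; apply: eq_bigr => i _; rewrite sqr_fnorm. Qed.

Let N0 : (0 < N)%N := ltnW N_ge2.
Let Np : 0 < N%:R :> R. Proof. by rewrite ltr0n. Qed.
Let Nn0 : N%:R != 0 :> R. Proof. exact: lt0r_neq0. Qed.

(** One matrix entry read across all nodes: [W ^+ t] acts on it as on an ordinary vector, so the
    Laplacian bounds transfer entry by entry. *)
Let tcol x a b : 'cV[R]_N := \col_i x i a b.

Let tcolE x x' : tuple_inner x x' =
  \sum_a \sum_b inner (tcol x a b) (tcol x' a b).
Proof.
rewrite /tuple_inner; under eq_bigr do rewrite innerE.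
rewrite exchange_big; apply: eq_bigr => a _ /=.
rewrite exchange_big; apply: eq_bigr => b _ /=.
by rewrite innerE; apply: eq_bigr => i _; rewrite big_ord1 !mxE.
Qed.

Let tcol_egrad x a b : tcol (egrad x) a b = tcol x a b - Wt *m tcol x a b.
Proof.
apply/colP => i; rewrite !mxE; congr (_ - _); rewrite summxE.
by apply: eq_bigr => j _; rewrite !mxE.
Qed.

Lemma egrad_edges x i : egrad x i = \sum_j Wt i j *: (x i - x j).
Proof.
rewrite /egrad -[X in X - _]scale1r -(commX_row_sum hW t i) scaler_suml -sumrB.
by apply: eq_bigr => j _; rewrite scalerBr.
Qed.

Lemma egrad_dev x y i : egrad (dev x y) i = egrad x i.
Proof.
by rewrite !egrad_edges; apply: eq_bigr => j _; rewrite /dev opprB addrA subrK.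
Qed.

Lemma sum_egrad x : \sum_i egrad x i = 0.
Proof.
rewrite /egrad sumrB exchange_big /= -[RHS](subrr (\sum_i x i)); congr (_ - _).
by apply: eq_bigr => j _; rewrite -scaler_suml (commX_col_sum hW) scale1r.
Qed.

Lemma tuple_inner_egradC x x' : tuple_inner x (egrad x') = tuple_inner x' (egrad x).
Proof.
rewrite /tuple_inner /egrad.
under eq_bigr do rewrite innerBr inner_sumr.
under [RHS]eq_bigr do rewrite innerBr inner_sumr.
rewrite !sumrB; congr (_ - _); first by apply: eq_bigr => i _; rewrite innerC.
rewrite exchange_big; apply: eq_bigr => i _; apply: eq_bigr => j _ /=.
by rewrite !innerZr (commX_sym hW) innerC.
Qed.

Lemma tuple_inner_dev_egrad x y :
  tuple_inner (dev x y) (egrad x) = tuple_inner x (egrad x).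
Proof.
rewrite /tuple_inner; under eq_bigr do rewrite innerBl.
by rewrite sumrB -inner_sumr sum_egrad inner0r subr0.
Qed.

Lemma sum_edges x : \sum_i \sum_j Wt i j * fnorm (x i - x j) ^+ 2 = 4 * phi x.
Proof. by rewrite /phi mulrA mulfV ?mul1r// pnatr_eq0. Qed.

Lemma phi_egrad x : 2 * phi x = tuple_inner x (egrad x).
Proof.
have h : 4 * phi x = tuple_inner x (egrad x) + tuple_inner x (egrad x).
  rewrite -sum_edges /tuple_inner.
  under [in RHS]eq_bigr do rewrite egrad_edges inner_sumr.
  rewrite [X in _ = _ + X]exchange_big -big_split; apply: eq_bigr => i _ /=.
  rewrite -big_split; apply: eq_bigr => j _ /=.
  by rewrite !innerZr (commX_sym hW t j) -mulrDr sqr_fnorm innerBl -(opprB (x i)) innerNr.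
by have -> : 2 * phi x = 2^-1 * (4 * phi x); [field | rewrite h; field].
Qed.

Lemma phi_ge0 x : 0 <= phi x.
Proof.
rewrite mulr_ge0// sumr_ge0// => i _; rewrite sumr_ge0// => j _.
by rewrite mulr_ge0 ?sqr_ge0// (commX_ge0 hW).
Qed.

Lemma sum_dev_mean x : \sum_i dev x (mean x) i = 0.
Proof.
rewrite sumrB sumr_const card_ord -scaler_nat scalerA mulfV// scale1r.
exact: subrr.
Qed.

Lemma phi_ge_mean x : mu W t * tuple_fnorm (dev x (mean x)) ^+ 2 <= 2 * phi x.
Proof.
rewrite phi_egrad -(tuple_inner_dev_egrad x (mean x)) -tuple_innerxx.
have -> : tuple_inner (dev x (mean x)) (egrad x) =
    tuple_inner (dev x (mean x)) (egrad (dev x (mean x))).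
  by apply: eq_bigr => i _; rewrite egrad_dev.
rewrite !tcolE mulr_sumr; apply: ler_sum => a _; rewrite mulr_sumr.
apply: ler_sum => b _; rewrite tcol_egrad; apply: (laplacian_ge N_ge2 hW t_ge1).
have /matrixP/(_ a b) := sum_dev_mean x; rewrite summxE [RHS]mxE => h.
by rewrite -[RHS]h; apply: eq_bigr => i _; rewrite mxE.
Qed.

Lemma egrad_sq_le x : tuple_fnorm (egrad x) ^+ 2 <= 2 * L * phi x.
Proof.
rewrite -mulrA mulrCA phi_egrad -tuple_innerxx !tcolE mulr_sumr.
apply: ler_sum => a _; rewrite mulr_sumr; apply: ler_sum => b _.
by rewrite tcol_egrad; apply: (laplacian_sq_le N_ge2 hW t_ge1).
Qed.

Lemma phi_le_dev x y : 2 * phi x <= L * tuple_fnorm (dev x y) ^+ 2.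
Proof.
rewrite phi_egrad -(tuple_inner_dev_egrad x y) -tuple_innerxx.
have -> : tuple_inner (dev x y) (egrad x) = tuple_inner (dev x y) (egrad (dev x y)).
  by apply: eq_bigr => i _; rewrite egrad_dev.
rewrite !tcolE mulr_sumr; apply: ler_sum => a _; rewrite mulr_sumr.
by apply: ler_sum => b _; rewrite tcol_egrad; apply: (laplacian_le N_ge2 hW).
Qed.

Lemma phi_le x : 2 * phi x <= L * tuple_fnorm x ^+ 2.
Proof.
have -> : tuple_fnorm x = tuple_fnorm (dev x 0); last exact: phi_le_dev.
by congr Num.sqrt; apply: eq_bigr => i _; rewrite /dev subr0.
Qed.

Lemma dev_mean_split x y : tuple_fnorm (dev x y) ^+ 2 =
  tuple_fnorm (dev x (mean x)) ^+ 2 + N%:R * fnorm (mean x - y) ^+ 2.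
Proof.
have -> : N%:R * fnorm (mean x - y) ^+ 2 = \sum_(i < N) fnorm (mean x - y) ^+ 2.
  by rewrite sumr_const card_ord mulr_natl.
have h : \sum_i inner (dev x (mean x) i) (mean x - y) = 0.
  by rewrite -inner_suml sum_dev_mean inner0l.
rewrite !sqr_tuple_fnorm -big_split /=; set S := RHS.
transitivity (S + 2 * \sum_i inner (dev x (mean x) i) (mean x - y)); last first.
  by rewrite h mulr0 addr0.
rewrite /S mulr_sumr -big_split; apply: eq_bigr => i _ /=.
rewrite !sqr_fnorm; have -> : dev x y i = dev x (mean x) i + (mean x - y).
  by rewrite /dev addrA subrK.
rewrite innerDl !(innerDr _ (dev x (mean x) i)).
by rewrite (innerC (mean x - y) (dev x _ i)); ring.
Qed.

Lemma mean_iam_tuple_dist x y : stiefelN x -> is_iam x y ->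
  fnorm (mean x - y) <= tuple_fnorm (dev x y) ^+ 2 / (2 * N%:R).
Proof. by rewrite sqr_tuple_fnorm; exact: mean_iam_dist. Qed.

(** With A = |x - y|^2, Pythagoras gives |x - mean|^2 = A - N |mean - y|^2, and |mean - y| <= A /
    (2N). *)
Lemma phi_ge_iam x y : stiefelN x -> is_iam x y ->
  mu W t * tuple_fnorm (dev x y) ^+ 2 * (1 - tuple_fnorm (dev x y) ^+ 2 / (4 * N%:R))
  <= 2 * phi x.
Proof.
move=> sx iy; apply: le_trans (phi_ge_mean x).
rewrite -mulrA; apply: ler_wpM2l; first exact/ltW/(mu_gt0 N_ge2 hW).
have := dev_mean_split x y; have := mean_iam_tuple_dist sx iy.
set A := tuple_fnorm (dev x y) ^+ 2; set f := fnorm _ => hf hA.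
have : N%:R * f ^+ 2 <= N%:R * (A / (2 * N%:R)) ^+ 2.
  by rewrite ler_pM2l// lerXn2r// nnegrE ?fnorm_ge0// (le_trans (fnorm_ge0 _) hf).
have -> : N%:R * (A / (2 * N%:R)) ^+ 2 = A * (A / (4 * N%:R)) by field.
rewrite mulrBr mulr1; move: (A * (A / _)) hA => c; lra.
Qed.

Lemma tangent_proj_tangent x y : stiefel y -> forall z, tangent y (tangent_proj y z).
Proof.
move=> sy z; rewrite /tangent /tangent_proj /=; set s := y^T *m z + _.
have ss : s^T = s by rewrite /s linearD /= !trmx_mul !trmxK addrC.
have -> : (z - 2^-1 *: (y *m s))^T = z^T - 2^-1 *: (s *m y^T).
  by rewrite linearB linearZ /= trmx_mul ss.
rewrite mulmxBr mulmxBl -scalemxAr -scalemxAl.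
rewrite mulmxA sy mul1mx -mulmxA sy mulmx1 addrACA -/s -opprD -scalerDl.
by rewrite (_ : 2^-1 + 2^-1 = 1 :> R) ?scale1r ?subrr//; field.
Qed.

Lemma tangent_proj_fnorm y z : stiefel y -> fnorm (tangent_proj y z) <= fnorm z.
Proof.
move=> sy; apply: ler_sq; rewrite ?fnorm_ge0// !sqr_fnorm /tangent_proj.
set s := y^T *m z + _.
have ss : s^T = s by rewrite /s linearD /= !trmx_mul !trmxK addrC.
have h : inner z (y *m s) = 2^-1 * inner s s.
  have h1 : inner (y^T *m z) s = inner z (y *m s) by rewrite inner_mull trmxK.
  have h2 : inner (z^T *m y) s = inner z (y *m s).
    by rewrite -inner_tr ss trmx_mul trmxK h1.
  have -> : inner s s = inner (y^T *m z) s + inner (z^T *m y) s by rewrite -innerDl.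
  by rewrite h1 h2; field.
rewrite innerBl !innerBr !innerZl !innerZr (innerC (y *m s) z).
rewrite (stiefel_inner_mul _ _ sy) h; have := inner_ge0 s; lra.
Qed.

Definition edge_gram x i : 'M[R]_r :=
  \sum_j Wt i j *: ((x i - x j)^T *m (x i - x j)).

Lemma psd_edge_gram x i : psd (edge_gram x i).
Proof.
apply: (big_ind (@psd R r)); [exact: psd0 | exact: psdD |] => j _.
by apply: psdZ; [exact: (commX_ge0 hW) | exact: psd_gram].
Qed.

Lemma edge_gram_fnorm x i :
  fnorm (edge_gram x i) <= \sum_j Wt i j * fnorm (x i - x j) ^+ 2.
Proof.
apply: le_trans (fnorm_sum _) _; apply: ler_sum => j _.
rewrite fnormZ ger0_norm ?(commX_ge0 hW)// ler_wpM2l ?(commX_ge0 hW)//.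
by rewrite sqr_fnorm; exact: psd_fnorm_le_tr (psd_gram _).
Qed.

Lemma edge_gram_inner x i y :
  inner (y *m edge_gram x i) y <=
  fnorm y ^+ 2 * \sum_j Wt i j * fnorm (x i - x j) ^+ 2.
Proof.
rewrite mulmx_sumr inner_suml mulr_sumr; apply: ler_sum => j _.
rewrite -scalemxAr innerZl mulrCA ler_wpM2l ?(commX_ge0 hW)//.
rewrite mulmxA inner_mulr -sqr_fnorm -exprMn.
have -> : x i - x j = ((x i - x j)^T)^T by rewrite trmxK.
rewrite -[fnorm (_^T^T)]/(Num.sqrt (inner _ _)) inner_tr -/(fnorm _).
by rewrite trmxK lerXn2r ?nnegrE ?mulr_ge0 ?fnorm_ge0// fnormM.
Qed.

(* [x_i^T (x_i - x_j) + (x_i - x_j)^T x_i = (x_i - x_j)^T (x_i - x_j)] on the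
   Stiefel manifold. *)
Lemma rgradE x i : stiefelN x ->
  rgrad x i = egrad x i - 2^-1 *: (x i *m edge_gram x i).
Proof.
move=> sx; rewrite /rgrad /tangent_proj; congr (_ - _ *: (_ *m _)).
rewrite egrad_edges mulmx_sumr linear_sum mulmx_suml -big_split.
apply: eq_bigr => j _ /=.
rewrite [(_ *: _)^T]linearZ /= -scalemxAr -scalemxAl -scalerDr; congr (_ *: _).
have si : (x i)^T *m x i = 1%:M := sx i; have sj : (x j)^T *m x j = 1%:M := sx j.
rewrite [(_ - _)^T]linearB /= !mulmxBr !mulmxBl si sj !opprB.
exact: addrC.
Qed.

Lemma edge_gram_sym x i : (edge_gram x i)^T = edge_gram x i.
Proof. by have [] := psd_edge_gram x i. Qed.

Lemma rgrad_tangent x i : stiefelN x -> tangent (x i) (rgrad x i).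
Proof. by move=> sx; exact: tangent_proj_tangent. Qed.

Lemma rgrad_sq_le x : stiefelN x -> tuple_fnorm (rgrad x) ^+ 2 <= 2 * L * phi x.
Proof.
move=> sx; apply: le_trans (egrad_sq_le x); rewrite !sqr_tuple_fnorm.
apply: ler_sum => i _; rewrite lerXn2r ?nnegrE ?fnorm_ge0//.
exact: tangent_proj_fnorm.
Qed.

(* The normal component x_i Q_i / 2 of the gradient pairs with x_i - x'_i to
   second order only, with a sign fixed by the positivity of Q_i. *)
Lemma egrad_rgrad x x' : stiefelN x -> stiefelN x' ->
  tuple_inner (fun i => x i - x' i) (egrad x) =
  tuple_inner (fun i => x i - x' i) (rgrad x) +
  4^-1 * \sum_i inner ((x i - x' i) *m edge_gram x i) (x i - x' i).
Proof.
move=> sx sx'; rewrite mulr_sumr -big_split; apply: eq_bigr => i _ /=.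
rewrite (rgradE _ sx) (innerBr _ (egrad x i)) innerZr (innerC (x i - x' i) (x i *m _)).
rewrite (stiefel_inner_sym (sx i) (sx' i) (edge_gram_sym x i)); lra.
Qed.

Lemma restricted_secant x y c : stiefelN x -> stiefel y ->
  (forall i, fnorm (dev x y i) ^+ 2 <= c) ->
  (2 - c) * phi x <= tuple_inner (dev x y) (rgrad x).
Proof.
move=> sx sy hc; have sy' : stiefelN (fun _ : 'I_N => y) by move=> i.
have := egrad_rgrad sx sy'.
rewrite (tuple_inner_dev_egrad x y : tuple_inner (fun i => x i - y) (egrad x) = _).
rewrite -phi_egrad -[tuple_inner _ (rgrad x)]/(tuple_inner (dev x y) (rgrad x)).
suff : \sum_i inner ((x i - y) *m edge_gram x i) (x i - y) <= c * (4 * phi x).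
  move: (phi x) => p; lra.
rewrite -sum_edges mulr_sumr; apply: ler_sum => i _.
apply: le_trans (edge_gram_inner _ _ _) _; apply: ler_wpM2r; last exact: hc.
by rewrite sumr_ge0// => j _; rewrite mulr_ge0 ?sqr_ge0// (commX_ge0 hW).
Qed.

Lemma rgrad_le_max (z : tuple) : stiefelN z -> tuple_fnorm (rgrad z) <= rgrad_max d r W t.
Proof.
move=> sz; apply: ub_le_sup; last by exists z.
(* The set under [sup] must be bounded: |grad|^2 <= 2 L phi <= L^2 |w|^2 with L <= 2 and |w|^2 = N
   r. *)
exists (Num.sqrt (2 * (2 * (N%:R * r%:R)))) => _ [w sw <-].
apply: ler_sq; rewrite ?sqrtr_ge0// [X in _ <= X]sqr_sqrtr ?mulr_ge0 ?ler0n//.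
have L0 := Lip_ge0 N_ge2 hW t; have L2 := Lip_le2 N_ge2 hW t_ge1.
have wN : tuple_fnorm w ^+ 2 = N%:R * r%:R.
  rewrite sqr_tuple_fnorm; under eq_bigr do rewrite sqr_fnorm.
  rewrite [RHS]mulr_natl -[X in _ *+ X]card_ord -sumr_const.
  by apply: eq_bigr => i _; rewrite /inner (sw i) mxtrace1.
apply: le_trans (rgrad_sq_le sw) _; have := phi_le w; rewrite wN.
have := phi_ge0 w; have : 0 <= N%:R * r%:R :> R by rewrite mulr_ge0 ?ler0n.
move: (N%:R * r%:R) (phi w) => q p; nra.
Qed.

(** * Effect of one iteration on deviation, mean and potential *)

Section Step.
Variables (alpha : R) (x x' : tuple) (y y' : 'M[R]_(d, r)).
Hypotheses (alpha_gt0 : 0 < alpha) (sx : stiefelN x) (sx' : stiefelN x').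
Hypothesis step : forall i, x' i = polar_retr (x i) (- (alpha *: rgrad x i)).
Hypotheses (iy : is_iam x y) (iy' : is_iam x' y').

Let A := tuple_fnorm (dev x y) ^+ 2.
Let A' := tuple_fnorm (dev x' y') ^+ 2.

Lemma step_tangent i : tangent (x i) (- (alpha *: rgrad x i)).
Proof.
rewrite /tangent /= -scaleNr -scalemxAr [(_ *: _)^T]linearZ /= -scalemxAl.
by rewrite -scalerDr (rgrad_tangent i sx) scaler0.
Qed.

Lemma step_le z i : stiefel z -> fnorm (x' i - z) <= fnorm (x i - alpha *: rgrad x i - z).
Proof.
move=> sz; rewrite step; apply: polar_retr_le => //.
by rewrite -step; exact: sx'.
Qed.

(** The bound [c] is left free: (1) takes the square of the largest deviation, (2) the total squared
    deviation. *)
Lemma step_decrease c nu : (forall i, fnorm (dev x y i) ^+ 2 <= c) ->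
  alpha * L <= nu * (2 - c) ->
  A' <= A - 2 * alpha * (1 - nu) * ((2 - c) * phi x).
Proof.
move=> hc hnu; have [sy _] := iy; have [_ ymin'] := iy'.
have /le_trans : A' <= tuple_fnorm (dev x' y) ^+ 2.
  rewrite /A' !sqr_tuple_fnorm; have := ymin' y sy.
  by under eq_bigr do rewrite fnormC; under [X in _ <= X -> _]eq_bigr do rewrite fnormC.
apply.
apply: (@le_trans _ _ (\sum_i fnorm (dev x y i - alpha *: rgrad x i) ^+ 2)).
  rewrite sqr_tuple_fnorm; apply: ler_sum => i _.
  rewrite lerXn2r ?nnegrE ?fnorm_ge0// (le_trans (step_le i sy))//.
  by rewrite /dev addrAC.
have -> : \sum_i fnorm (dev x y i - alpha *: rgrad x i) ^+ 2 =
    A - 2 * alpha * tuple_inner (dev x y) (rgrad x) +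
    alpha ^+ 2 * tuple_fnorm (rgrad x) ^+ 2.
  rewrite /A !sqr_tuple_fnorm !mulr_sumr -sumrB -big_split.
  apply: eq_bigr => i _ /=; rewrite !sqr_fnorm.
  move: (dev x y i) (rgrad x i) => u v.
  by rewrite innerBl !innerBr !innerZl !innerZr (innerC v u); ring.
have h1 := restricted_secant sx sy hc; have h2 := rgrad_sq_le sx.
have h3 := phi_ge0 x.
have h4 : alpha ^+ 2 * tuple_fnorm (rgrad x) ^+ 2 <= alpha * 2 * (nu * (2 - c)) * phi x.
  have : alpha ^+ 2 * tuple_fnorm (rgrad x) ^+ 2 <= alpha ^+ 2 * (2 * L * phi x).
    by rewrite ler_wpM2l ?sqr_ge0.
  move/le_trans; apply.
  have -> : alpha ^+ 2 * (2 * L * phi x) = alpha * 2 * (alpha * L) * phi x by ring.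
  by rewrite ler_wpM2r// ler_wpM2l// mulr_ge0// ltW.
have h5 : alpha * ((2 - c) * phi x) <= alpha * tuple_inner (dev x y) (rgrad x).
  by rewrite ler_pM2l.
move: h4 h5; move: (tuple_inner _ _) (phi x) (alpha ^+ 2 * _) => s p q; lra.
Qed.

Variable M : R.
Hypothesis hM : retr_second_order d r M.

Lemma step_retr_error i :
  fnorm (x' i - (x i - alpha *: rgrad x i)) <= M * alpha ^+ 2 * fnorm (rgrad x i) ^+ 2.
Proof.
rewrite step; apply: le_trans (hM (sx i) (step_tangent i)) _.
by rewrite fnormN fnormZ exprMn real_normK ?num_real// mulrA.
Qed.

(** The Euclidean gradients sum to zero, so only second-order terms move the mean. The constant is 6
    = 4 + 2: the retraction errors cost at most alpha |grad|^2 <= 4 alpha A, the normal components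
    (alpha / 2) 4 phi <= 2 alpha A. *)
Lemma mean_step : alpha * M <= 1 ->
  fnorm (mean x' - mean x) <= 6 * alpha * (A / N%:R).
Proof.
move=> aM; rewrite -scalerBr fnormZ ger0_norm ?invr_ge0 ?ler0n//.
rewrite ler_pdivrMl// (_ : N%:R * _ = 6 * alpha * A); last by field.
rewrite -sumrB.
have -> : \sum_i (x' i - x i) = \sum_i (x' i - (x i - alpha *: rgrad x i)) +
    (alpha / 2) *: \sum_i (x i *m edge_gram x i).
  transitivity (\sum_i (x' i - (x i - alpha *: rgrad x i)) - alpha *: \sum_i rgrad x i).
    rewrite scaler_sumr -sumrB; apply: eq_bigr => i _.
    by rewrite opprB addrCA addrAC subrr add0r.
  congr (_ + _); under eq_bigr do rewrite (rgradE _ sx).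
  by rewrite sumrB sum_egrad sub0r -scaler_sumr scalerN opprK scalerA.
have h0 := phi_ge0 x; have L0 := Lip_ge0 N_ge2 hW t; have L2 := Lip_le2 N_ge2 hW t_ge1.
have A0 : 0 <= A by exact: sqr_ge0.
have hp : phi x <= A by have := phi_le_dev x y; rewrite -/A; nra.
have h1 : fnorm (\sum_i (x' i - (x i - alpha *: rgrad x i))) <= 4 * alpha * A.
  apply: le_trans (fnorm_sum _) _.
  apply: (@le_trans _ _ (M * alpha ^+ 2 * tuple_fnorm (rgrad x) ^+ 2)).
    rewrite sqr_tuple_fnorm mulr_sumr; apply: ler_sum => i _; exact: step_retr_error.
  have -> : M * alpha ^+ 2 * tuple_fnorm (rgrad x) ^+ 2 =
    alpha * (alpha * M * tuple_fnorm (rgrad x) ^+ 2) by ring.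
  rewrite (_ : 4 * alpha * A = alpha * (4 * A)); last by ring.
  rewrite ler_pM2l//.
  have : alpha * M * tuple_fnorm (rgrad x) ^+ 2 <= tuple_fnorm (rgrad x) ^+ 2.
    by rewrite ler_piMl ?sqr_ge0.
  move=> /le_trans; apply; apply: le_trans (rgrad_sq_le sx) _.
  by have : L * phi x <= 2 * A; [apply: ler_pM | lra].
have h2 : fnorm ((alpha / 2) *: \sum_i (x i *m edge_gram x i)) <= 2 * alpha * A.
  rewrite fnormZ ger0_norm ?divr_ge0 ?(ltW alpha_gt0)//.
  have : fnorm (\sum_i (x i *m edge_gram x i)) <= 4 * phi x.
    rewrite -sum_edges; apply: le_trans (fnorm_sum _) _; apply: ler_sum => i _.
    by rewrite (stiefel_fnorm_mul _ (sx i)) edge_gram_fnorm.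
  move: (fnorm _) => f hf.
  have : alpha * f <= alpha * (4 * A) by rewrite ler_pM2l//; lra.
  lra.
by apply: le_trans (fnormD _ _) _; lra.
Qed.

Lemma iam_step : alpha * M <= 1 -> A <= N%:R / 12 -> A' <= A ->
  fnorm (y - y') <= 7 * alpha * (A / N%:R).
Proof.
move=> aM hA hA'.
(* A <= N / 12 is the Lipschitz condition for c = 1/24, and 6 / (1 - 1/24) <= 7. *)
have := @iam_lipschitz R N d r x x' y y' 24^-1 N0 sx sx' iy iy'.
have -> : 2 * N%:R * 24^-1 = N%:R / 12 :> R by field.
rewrite -!sqr_tuple_fnorm -/A -/A' => /(_ hA (le_trans hA' hA)).
rewrite fnormC [X in _ <= X -> _]fnormC => h; have := mean_step aM.
have : 0 <= alpha * (A / N%:R) by rewrite mulr_ge0 ?divr_ge0 ?sqr_ge0// ltW.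
move: h; rewrite -!mulrA; move: (alpha * _) (fnorm (mean x' - _)) (fnorm _) => *; lra.
Qed.

(** For alpha <= 1 the unretracted step is a convex combination of the old deviation and a remainder
    of norm at most delta1^2 / 2 (mean against xbar) + delta1 / 2 (mixing) + 2 delta2^2 (normal
    component). Adding 7 delta1^2 for the motion of xbar keeps this below delta2. *)
Lemma step_inf delta1 delta2 : alpha <= 1 -> alpha * M <= 1 -> enough_rounds W t ->
  0 < delta1 -> 0 < delta2 -> delta1 <= delta2 / 5 -> delta2 <= 1 / 6 ->
  A <= N%:R * delta1 ^+ 2 -> A' <= A ->
  (forall i, fnorm (dev x y i) <= delta2) ->
  forall i, fnorm (dev x' y' i) <= delta2.
Proof.
move=> a1 aM rounds d10 d20 d12 d26 hA hA' hD i; have [sy _] := iy.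
have hAN : A / N%:R <= delta1 ^+ 2 by rewrite ler_pdivrMr// mulrC.
have hA12 : A <= N%:R / 12 by apply: le_trans hA _; rewrite ler_pM2l//; nra.
have h1 : fnorm (y - y') <= 7 * alpha * delta1 ^+ 2.
  apply: le_trans (iam_step aM hA12 hA') _.
  by rewrite ler_wpM2l// mulr_ge0// ltW.
have decomp : x i - alpha *: rgrad x i - y = (1 - alpha) *: dev x y i +
    alpha *: ((mean x - y) + \sum_j (Wt i j - N%:R^-1) *: dev x y j +
              2^-1 *: (x i *m edge_gram x i)).
  rewrite (rgradE _ sx) egrad_edges.
  have -> : \sum_j Wt i j *: (x i - x j) =
      dev x y i - (mean x - y + \sum_j (Wt i j - N%:R^-1) *: dev x y j).
    under [in RHS]eq_bigr do rewrite scalerBl.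
    rewrite sumrB -[\sum_j N%:R^-1 *: _]scaler_sumr /dev [in RHS]sumrB.
    rewrite sumr_const card_ord -[y *+ N]scaler_nat scalerBr scalerA mulVf// scale1r.
    rewrite -/(mean x) [X in _ - X]addrC subrK.
    rewrite -[X in X - _]scale1r -(commX_row_sum hW t i) scaler_suml -sumrB.
    by apply: eq_bigr => j _; rewrite -scalerBr opprB addrA subrK.
  set u := dev x y i; set v := mean x - y + _; set w := 2^-1 *: _.
  rewrite addrAC -[x i - y]/u; clearbody u v w.
  rewrite scalerBl scale1r !scalerBr scalerDr !opprB -!addrA; congr (_ + _).
  by rewrite [RHS]addrC addrA; congr (_ - _); exact: addrC.
have h2 : fnorm (mean x - y) <= delta1 ^+ 2 / 2.
  apply: le_trans (mean_iam_tuple_dist sx iy) _; rewrite -/A ler_pdivrMr ?mulr_gt0//.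
  by apply: le_trans hA _; rewrite le_eqVlt; apply/orP; left; apply/eqP; field.
have h3 : fnorm (\sum_j (Wt i j - N%:R^-1) *: dev x y j) <= delta1 / 2.
  apply: le_trans (fnorm_sumZ _ _) _.
  rewrite -[Num.sqrt (\sum_j fnorm _ ^+ 2)]/(tuple_fnorm _).
  have sN : 0 < Num.sqrt N%:R :> R by rewrite sqrtr_gt0.
  have -> : delta1 / 2 = 1 / (2 * Num.sqrt N%:R) * (Num.sqrt N%:R * delta1).
    by field; exact: lt0r_neq0.
  apply: ler_pM; rewrite ?sqrtr_ge0//.
    apply: le_trans (enough_rounds_sigma N_ge2 hW t_ge1 rounds).
    apply: ler_sq; first exact: (sigmaX_ge0 hW).
    rewrite sqr_sqrtr ?(comm_row_dist N_ge2 hW)//.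
    by rewrite sumr_ge0// => j _; rewrite sqr_ge0.
  apply: ler_sq; first by rewrite mulr_ge0 ?ltW.
  by rewrite exprMn (sqr_sqrtr (ltW Np)).
have h4 : fnorm (2^-1 *: (x i *m edge_gram x i)) <= 2 * delta2 ^+ 2.
  rewrite fnormZ (stiefel_fnorm_mul _ (sx i)) ger0_norm ?invr_ge0//.
  suff : fnorm (edge_gram x i) <= 4 * delta2 ^+ 2 by move: (fnorm _) => f; lra.
  apply: le_trans (edge_gram_fnorm _ _) _.
  have -> : 4 * delta2 ^+ 2 = \sum_j Wt i j * (4 * delta2 ^+ 2).
    by rewrite -mulr_suml (commX_row_sum hW) mul1r.
  apply: ler_sum => j _; rewrite ler_wpM2l ?(commX_ge0 hW)//.
  have -> : 4 * delta2 ^+ 2 = (2 * delta2) ^+ 2 by ring.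
  rewrite lerXn2r ?nnegrE ?fnorm_ge0 ?mulr_ge0 ?(ltW d20)//.
  have -> : x i - x j = dev x y i - dev x y j by rewrite /dev opprB addrA subrK.
  apply: le_trans (fnormD _ _) _; rewrite fnormN; have := hD i; have := hD j; lra.
have h5 : fnorm (x' i - y) <= (1 - alpha) * delta2 +
    alpha * (delta1 ^+ 2 / 2 + delta1 / 2 + 2 * delta2 ^+ 2).
  apply: le_trans (step_le i sy) _; rewrite decomp.
  apply: le_trans (fnormD _ _) _; rewrite !fnormZ !ger0_norm ?subr_ge0 ?(ltW alpha_gt0)//.
  apply: lerD; first by rewrite ler_wpM2l ?subr_ge0.
  rewrite ler_pM2l//; apply: le_trans (fnormD _ _) _; apply: lerD => //.
  by apply: le_trans (fnormD _ _) _; apply: lerD.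
have -> : dev x' y' i = (x' i - y) + (y - y') by rewrite /dev addrA subrK.
apply: le_trans (fnormD _ _) _; apply: le_trans (lerD h5 h1) _.
have : alpha * (delta1 ^+ 2 / 2 + delta1 / 2 + 2 * delta2 ^+ 2 + 7 * delta1 ^+ 2) <=
    alpha * delta2 by rewrite ler_pM2l//; nra.
lra.
Qed.

(** [phi] is quadratic, so its expansion along v = x' - x is exact. The normal component only lowers
    the linear term, |v| <= alpha |g|, and the retraction error costs M alpha^2 G |g|^2: twice the
    change is at most - alpha |g|^2 (2 - alpha (L + 2 M G)). *)
Lemma phi_step : alpha * (L + 2 * M * rgrad_max d r W t) <= 2 -> phi x' <= phi x.
Proof.
move=> ha; set G := rgrad_max _ _ _ _ in ha; set g := rgrad x.
pose v i := x' i - x i; have L0 := Lip_ge0 N_ge2 hW t.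
have e1 : 2 * phi x' = 2 * phi x + 2 * tuple_inner v (egrad x) + 2 * phi v.
  have ev i : egrad v i = egrad x' i - egrad x i.
    rewrite !egrad_edges -sumrB; apply: eq_bigr => j _.
    by rewrite -scalerBr; congr (_ *: _); rewrite /v opprD addrACA -opprD.
  rewrite !phi_egrad.
  have -> : tuple_inner v (egrad v) = tuple_inner x' (egrad x') -
      tuple_inner x (egrad x') - tuple_inner x' (egrad x) + tuple_inner x (egrad x).
    rewrite /tuple_inner -!sumrB -big_split; apply: eq_bigr => i _ /=.
    by rewrite ev innerBl !innerBr; ring.
  have -> : tuple_inner v (egrad x) = tuple_inner x' (egrad x) - tuple_inner x (egrad x).
    by rewrite /tuple_inner -sumrB; apply: eq_bigr => i _; rewrite innerBl.
  by rewrite (tuple_inner_egradC x x'); ring.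
have negv z : tuple_inner (fun i => x i - x' i) z = - tuple_inner v z.
  by rewrite /tuple_inner -sumrN; apply: eq_bigr => i _; rewrite -innerNl opprB.
have h1 : tuple_inner v (egrad x) <= tuple_inner v g.
  have := egrad_rgrad sx sx'; rewrite !negv => h.
  have : 0 <= \sum_i inner ((x i - x' i) *m edge_gram x i) (x i - x' i).
    by rewrite sumr_ge0// => i _; exact/psd_inner_mulr_ge0/psd_edge_gram.
  by move: h; move: (\sum_i _) => q; rewrite -/g; lra.
have h2 : tuple_fnorm v ^+ 2 <= alpha ^+ 2 * tuple_fnorm g ^+ 2.
  rewrite !sqr_tuple_fnorm mulr_sumr; apply: ler_sum => i _.
  rewrite -exprMn lerXn2r ?nnegrE ?mulr_ge0 ?fnorm_ge0 ?(ltW alpha_gt0)//.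
  apply: le_trans (step_le i (sx i)) _.
  by rewrite addrAC subrr sub0r fnormN fnormZ gtr0_norm.
pose w i := x' i - (x i - alpha *: g i).
have h3 : tuple_inner v g = - alpha * tuple_fnorm g ^+ 2 + tuple_inner w g.
  rewrite -tuple_innerxx /tuple_inner mulr_sumr -big_split; apply: eq_bigr => i _ /=.
  have -> : v i = w i - alpha *: g i by rewrite /w opprB addrCA addrAC subrr add0r.
  by rewrite innerBl innerZl; ring.
have h4 : tuple_inner w g <= M * alpha ^+ 2 * tuple_fnorm g ^+ 2 * G.
  have gi i : fnorm (g i) <= G.
    apply: le_trans (rgrad_le_max sx); apply: ler_sq; first exact: sqrtr_ge0.
    rewrite sqr_tuple_fnorm (bigD1 i)//= lerDl.
    by rewrite sumr_ge0// => j _; rewrite sqr_ge0.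
  rewrite sqr_tuple_fnorm mulr_sumr mulr_suml; apply: ler_sum => i _.
  apply: le_trans (inner_CS _ _) _; apply: ler_pM; rewrite ?fnorm_ge0//.
  exact: step_retr_error.
have h5 := phi_le v.
have h6 : L * tuple_fnorm v ^+ 2 <= L * (alpha ^+ 2 * tuple_fnorm g ^+ 2).
  by rewrite ler_wpM2l.
have h7 : 0 <= alpha * tuple_fnorm g ^+ 2 by rewrite mulr_ge0 ?sqr_ge0// ltW.
have h8 : alpha * tuple_fnorm g ^+ 2 * (alpha * (L + 2 * M * G)) <=
    alpha * tuple_fnorm g ^+ 2 * 2 by rewrite ler_wpM2l.
move: h3 h4 h6 h8 h7 h1 h5 e1.
move: (tuple_inner v _) (tuple_inner v g) (tuple_inner w g) (phi x) (phi x') (phi v).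
move: (tuple_fnorm g ^+ 2) (tuple_fnorm v ^+ 2) => *; lra.
Qed.

End Step.

End ConsensusPotential.

(** * Geometric decay and convergence *)

Section GeometricDecay.
Context {R : realType}.

(** No sign of [q] is assumed: if q < 0, then 0 <= a 1 <= q a 0 forces a 0 = 0, and the whole
    sequence vanishes. *)
Lemma geometric_decay (a : nat -> R) q : (forall k, 0 <= a k) ->
  (forall k, a k.+1 <= q * a k) -> forall k, a k <= q ^+ k * a 0%N.
Proof.
move=> a0 aS; have [q0|q0] := leP 0 q; last first.
  have az : a 0%N = 0.
    by apply/eqP; rewrite eq_le a0 andbT leNgt; apply/negP => p; have := aS 0%N;
      have := a0 1%N; nra.
  elim=> [|k IHk]; first by rewrite expr0 mul1r.
  rewrite az mulr0 in IHk *; have ak : a k = 0 by apply/eqP; rewrite eq_le IHk a0.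
  by have := aS k; rewrite ak !mulr0.
elim=> [|k IHk]; first by rewrite expr0 mul1r.
by apply: le_trans (aS k) _; rewrite exprS -mulrA ler_wpM2l.
Qed.

Lemma is_cvg_geometric_increments (u : R^nat) C q : 0 <= q < 1 ->
  (forall k, `|u k.+1 - u k| <= C * q ^+ k) -> cvgn u.
Proof.
move=> /andP[q0 q1] hu.
have -> : u = (fun n => u 0%N + series (telescope u) n).
  by apply/funext => n; rewrite -eq_sum_telescope.
apply: is_cvgD; first exact: is_cvg_cst.
apply: normed_cvg; apply: (@series_le_cvg _ _ (geometric C q)).
- by move=> n; exact: normr_ge0.
- by move=> n; apply: le_trans (hu n).
- by move=> n; exact: hu.
by apply: is_cvg_geometric_series; rewrite ger0_norm.
Qed.

Lemma normr_entry_le d r (x : 'M[R]_(d, r)) i j : `|x i j| <= fnorm x.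
Proof.
apply: ler_sq; rewrite ?fnorm_ge0// real_normK ?num_real// sqr_fnorm innerE.
rewrite (bigD1 i)//= (bigD1 j)//= -expr2 -addrA lerDl addr_ge0// sumr_ge0// => k _.
  by rewrite -expr2 sqr_ge0.
by rewrite sumr_ge0// => l _; rewrite -expr2 sqr_ge0.
Qed.

Lemma cvg_mx_entries d r (y : nat -> 'M[R]_(d, r)) (l : 'M[R]_(d, r)) :
  (forall i j, y k i j @[k --> \oo] --> l i j) -> y k @[k --> \oo] --> l.
Proof.
move=> h S [P lP PS].
have hP : \forall k \near \oo, forall i j, P i j (y k i j).
  apply: (@filter_forall _ _ (fun i k => forall j, P i j (y k i j))) => i.
  apply: (@filter_forall _ _ (fun j k => P i j (y k i j))) => j.
  exact: (h i j _ (lP i j)).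
by apply: filterS hP => k; exact: PS.
Qed.

(** Each entry is a telescoping series dominated by a geometric one; the manifold is given by
    polynomial equations in the entries, which pass to the limit. *)
Lemma stiefel_cvg_geometric d r (y : nat -> 'M[R]_(d, r)) C q : 0 <= q < 1 ->
  (forall k, stiefel (y k)) -> (forall k, fnorm (y k - y k.+1) <= C * q ^+ k) ->
  exists2 l, stiefel l & y k @[k --> \oo] --> l.
Proof.
move=> hq sy hy; pose l : 'M[R]_(d, r) := \matrix_(i, j) limn (fun k => y k i j).
have yl i j : y k i j @[k --> \oo] --> l i j.
  rewrite mxE; apply: (@is_cvg_geometric_increments _ C q) => // k.
  apply: le_trans (hy k); rewrite fnormC; apply: le_trans (normr_entry_le _ i j).
  by rewrite !mxE.
exists l; last exact: cvg_mx_entries.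
apply/matrixP => i j.
have cl : \sum_m y k m i * y k m j @[k --> \oo] --> \sum_m l m i * l m j.
  by apply: cvg_big => [|m _]; [exact: add_continuous | apply: cvgM; exact: yl].
have -> : (l^T *m l) i j = \sum_m l m i * l m j.
  by rewrite mxE; apply: eq_bigr => m _; rewrite mxE.
rewrite -(cvg_lim _ cl)//.
have -> : (fun k => \sum_m y k m i * y k m j) = (fun=> (1%:M : 'M[R]_r) i j).
  apply/funext => k; rewrite -(sy k) mxE.
  by apply: eq_bigr => m _; rewrite mxE.
exact: lim_cst.
Qed.

End GeometricDecay.

Lemma fnorm_le_inf {R : realType} N d r (x : 'I_N -> 'M[R]_(d, r)) i :
  fnorm (x i) <= tuple_fnorm_inf x.
Proof. exact: (le_bigmax _ (fun i => fnorm (x i))). Qed.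

Lemma tuple_fnorm_inf_ge0 {R : realType} N d r (x : 'I_N -> 'M[R]_(d, r)) :
  0 <= tuple_fnorm_inf x.
Proof. exact: bigmax_ge_id. Qed.

Lemma fnorm_le_tuple {R : realType} N d r (x : 'I_N -> 'M[R]_(d, r)) i :
  fnorm (x i) ^+ 2 <= tuple_fnorm x ^+ 2.
Proof.
rewrite sqr_tuple_fnorm (bigD1 i)//= lerDl.
by rewrite sumr_ge0// => j _; rewrite sqr_ge0.
Qed.

Theorem theorem2 (R : realType) (d r N : nat)
    (r_ge1 : (1 <= r)%N) (r_le_d : (r <= d)%N) (N_ge2 : (2 <= N)%N)
    (e : rel 'I_N) (W : 'M[R]_N) (hW : communication_matrix e W)
    (M : R) (M_gt0 : 0 < M) (hM : retr_second_order d r M)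
    (iam : ('I_N -> 'M[R]_(d, r)) -> 'M[R]_(d, r)) (hiam : iam_selection iam)
    (t : nat) (t_ge1 : (1 <= t)%N)
    (alpha : R) (alpha_gt0 : 0 < alpha)
    (x : nat -> 'I_N -> 'M[R]_(d, r))
    (x_st : forall k, stiefelN (x k))
    (hx : is_drcs W t alpha x) :
  (forall nu delta1 delta2 : R,
     0 < nu < 1 ->
     0 < delta1 -> 0 < delta2 ->
     delta1 <= 1 / (5 * Num.sqrt r%:R) * delta2 ->
     delta2 <= 1 / 6 ->
     enough_rounds W t ->
     region_R iam delta1 delta2 (x 0%N) ->
     (forall k, alpha <=
        nu * (2 - tuple_fnorm_inf (dev (x k) (iam (x k))) ^+ 2) / Lip W t) ->
     alpha <= 1 -> alpha <= 1 / M ->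
     [/\ forall k, region_R iam delta1 delta2 (x k),
         forall k, tuple_fnorm (dev (x k) (iam (x k))) ^+ 2 <=
           (1 - 2 * alpha * (1 - nu) * gamma_R W t r delta1 delta2) ^+ k *
           tuple_fnorm (dev (x 0%N) (iam (x 0%N))) ^+ 2 &
         alpha <= 1 / (2 * M * rgrad_max d r W t + Lip W t) ->
         exists2 xstar : 'M[R]_(d, r), stiefel xstar &
           iam (x k) @[k --> \oo] --> xstar])
  /\
  (forall delta3 : R,
     0 < delta3 ->
     delta3 <= Num.min (1 / Num.sqrt N%:R) (1 / (4 * Num.sqrt r%:R)) ->
     region_l W t iam delta3 (x 0%N) ->
     alpha <= 2 / (Lip W t + 2 * M * rgrad_max d r W t) ->
     (forall k, alpha <=
        (2 - tuple_fnorm (dev (x k) (iam (x k))) ^+ 2) / (2 * Lip W t)) ->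
     forall k, tuple_fnorm (dev (x k) (iam (x k))) ^+ 2 <=
       (1 - 2 * alpha * (1 - 1 / 2) * gamma_l W t delta3 (x 0%N)) ^+ k *
       tuple_fnorm (dev (x 0%N) (iam (x 0%N))) ^+ 2).
Proof.
have L0 := Lip_ge0 N_ge2 hW t; have mu0 := mu_gt0 N_ge2 hW t_ge1.
have Np : 0 < N%:R :> R by rewrite ltr0n ltnW.
have rp : 1 <= r%:R :> R by rewrite ler1n.
have sr : 1 <= Num.sqrt r%:R :> R by rewrite -[X in X <= _]sqrtr1 ler_sqrt// ler0n.
have sr2 : Num.sqrt r%:R ^+ 2 = r%:R :> R by rewrite sqr_sqrtr// ler0n.
have hy k : is_iam (x k) (iam (x k)) by exact: hiam.
pose a k := tuple_fnorm (dev (x k) (iam (x k))) ^+ 2.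
have a0 k : 0 <= a k by exact: sqr_ge0.
(* If [Lip W t] were 0, the quotient would be 0 and contradict [alpha_gt0]. *)
have divL (c : R) : alpha <= c / Lip W t -> alpha * Lip W t <= c.
  move: L0; rewrite le_eqVlt => /predU1P[<-|Lp]; last by rewrite ler_pdivlMr.
  by rewrite invr0 mulr0 leNgt alpha_gt0.
have phik k : mu W t * a k * (1 - a k / (4 * N%:R)) <= 2 * phi W t (x k).
  exact: (phi_ge_iam N_ge2 hW t_ge1).
(* The estimate holds with 1 - b / 4; it is weakened to the factor 1 - 4 r b shared by both
   rates. *)
have phi_dev k b : 0 <= b -> a k <= N%:R * b ->
    mu W t * (1 - 4 * r%:R * b) * a k <= 2 * phi W t (x k).
  move=> b0 hak; apply: le_trans (phik k); rewrite mulrAC; apply: ler_wpM2l.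
    by rewrite mulr_ge0// ltW.
  rewrite lerD2l lerN2 ler_pdivrMr ?mulr_gt0//.
  apply: le_trans hak _; have : 0 <= N%:R * b by rewrite mulr_ge0// ltW.
  have -> : 4 * r%:R * b * (4 * N%:R) = 16 * r%:R * (N%:R * b) by ring.
  by move: (N%:R * b) => p; nra.
have decr k c nu : (forall i, fnorm (dev (x k) (iam (x k)) i) ^+ 2 <= c) ->
    alpha * Lip W t <= nu * (2 - c) ->
    a k.+1 <= a k - 2 * alpha * (1 - nu) * ((2 - c) * phi W t (x k)).
  exact: (step_decrease r_ge1 N_ge2 hW t_ge1 alpha_gt0 (x_st k) (x_st k.+1)
    (hx k) (hy k) (hy k.+1)).
split.
- move=> nu delta1 delta2 /andP[nu0 nu1] d10 d20 d12 d26 rounds reg0 halpha a1 aM.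
  have {}aM : alpha * M <= 1 by rewrite -ler_pdivlMr.
  have d1r : delta1 * (5 * Num.sqrt r%:R) <= delta2.
    by move: d12; rewrite mulrAC mul1r ler_pdivlMr// mulr_gt0// (lt_le_trans ltr01).
  have d15 : delta1 <= delta2 / 5 by nra.
  (* This is where the factor 5 sqrt r enters: it keeps 1 - 4 r delta1^2, hence [gam], positive. *)
  have rd1 : r%:R * delta1 ^+ 2 <= delta2 ^+ 2 / 25.
    rewrite -sr2 -exprMn; set s := Num.sqrt _ in sr d1r *.
    have : (s * delta1) ^+ 2 <= (delta2 / 5) ^+ 2.
      rewrite lerXn2r// ?nnegrE ?mulr_ge0 ?divr_ge0//.
      all: rewrite ?(ltW d10) ?(ltW d20) ?(le_trans ler01)//.
      lra.
    lra.
  set gam := gamma_R _ _ _ _ _.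
  have g0 : 0 < gam by rewrite /gam /gamma_R mulr_gt0// mulr_gt0//; nra.
  have stepk k : region_R iam delta1 delta2 (x k) ->
      a k.+1 <= (1 - 2 * alpha * (1 - nu) * gam) * a k.
    move=> [[_ hA] [_ hinf]]; have := halpha k; set c := tuple_fnorm_inf _ in hinf *.
    have c0 : 0 <= c by exact: tuple_fnorm_inf_ge0.
    move=> /divL hc; have := decr k (c ^+ 2) nu; move=> /(_ _ hc) h.
    have {}h : a k.+1 <= a k - 2 * alpha * (1 - nu) * ((2 - c ^+ 2) * phi W t (x k)).
      by apply: h => i; rewrite lerXn2r ?nnegrE ?fnorm_ge0// fnorm_le_inf.
    apply: le_trans h _; rewrite [X in _ <= X]mulrBl mul1r lerD2l lerN2.
    rewrite -[X in X <= _]mulrA.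
    apply: ler_wpM2l; first by rewrite !mulr_ge0 ?subr_ge0 ?ltW.
    have p0 : 0 <= phi W t (x k) by exact: (phi_ge0 t hW).
    have c2 : c ^+ 2 <= delta2 ^+ 2 by rewrite lerXn2r ?nnegrE ?(ltW d20).
    apply: (@le_trans _ _ ((2 - delta2 ^+ 2) * phi W t (x k))); last first.
      by rewrite ler_wpM2r// lerD2l lerN2.
    have := phi_dev k (delta1 ^+ 2) (sqr_ge0 _) hA.
    rewrite /gam /gamma_R; set p := phi _ _ _; set q := 1 - 4 * _ * _.
    have : 0 <= 1 - delta2 ^+ 2 / 2 by nra.
    set s := 1 - _ / 2 => s0 h.
    have -> : (2 - delta2 ^+ 2) * p = s * (2 * p) by rewrite /s; field.
    have -> : q * s * mu W t * a k = s * (mu W t * q * a k) by ring.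
    exact: ler_wpM2l.
  have qle1 : 1 - 2 * alpha * (1 - nu) * gam < 1.
    by rewrite gtrBl mulr_gt0// mulr_gt0 ?subr_gt0// mulr_gt0.
  have regS k : region_R iam delta1 delta2 (x k) -> region_R iam delta1 delta2 (x k.+1).
    move=> rk; have hA' : a k.+1 <= a k.
      by apply: le_trans (stepk k rk) _; rewrite ler_piMl// ltW.
    case: rk => -[_ hA] [_ hinf]; split; split => //; first exact: le_trans hA' hA.
    apply: bigmax_le => [|i _]; first exact: ltW.
    apply: (step_inf r_ge1 N_ge2 hW t_ge1 alpha_gt0 (x_st k) (x_st k.+1) (hx k)
      (hy k) (hy k.+1) hM a1 aM rounds d10 d20 d15 d26 hA hA') => j.
    exact: le_trans (fnorm_le_inf _ _) hinf.
  have reg k : region_R iam delta1 delta2 (x k) by elim: k => // k; exact: regS.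
  have stepk' k := stepk k (reg k).
  split=> //; first exact: geometric_decay.
  (* The geometric series needs a ratio in [0, 1), whereas the rate itself is only known to be below
     1. *)
  move=> _; pose q := Num.max 0 (1 - 2 * alpha * (1 - nu) * gam).
  have hq : 0 <= q < 1 by rewrite le_max lexx /= gt_max ltr01.
  have aq k : a k <= q ^+ k * a 0%N.
    apply: geometric_decay => // j; apply: le_trans (stepk' j) _.
    by rewrite ler_wpM2r// le_max lexx orbT.
  apply: (@stiefel_cvg_geometric _ _ _ _ (7 * alpha / N%:R * a 0%N) q) => // k.
    by have [] := hy k.
  apply: (@le_trans _ _ (7 * alpha * (a k / N%:R))).
    have hA : a k <= N%:R * delta1 ^+ 2 by have [[_ +] _] := reg k.
    apply: (iam_step N_ge2 hW t_ge1 alpha_gt0 (x_st k) (x_st k.+1) (hx k)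
      (hy k) (hy k.+1) hM aM).
      by apply: le_trans hA _; rewrite ler_pM2l//; nra.
    by apply: le_trans (stepk' k) _; rewrite ler_piMl// ltW.
  have -> : 7 * alpha / N%:R * a 0%N * q ^+ k = 7 * alpha * (q ^+ k * a 0%N / N%:R).
    by ring.
  by rewrite ler_pM2l ?mulr_gt0// ler_pM2r ?invr_gt0.
move=> delta3 d30; rewrite le_min => /andP[d3N d3r] [_ phi0 hA0] hG halpha.
have sN : 0 < Num.sqrt N%:R :> R by rewrite sqrtr_gt0.
have Nd3 : N%:R * delta3 ^+ 2 <= 1.
  rewrite -(sqr_sqrtr (ltW Np)) -exprMn expr_le1// ?mulr_ge0 ?(ltW d30) ?(ltW sN)//.
  by rewrite mulrC -ler_pdivlMr.
have rd3 : r%:R * delta3 ^+ 2 <= 1 / 16.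
  move: d3r; rewrite ler_pdivlMr ?mulr_gt0 ?(lt_le_trans ltr01 sr)// => d3r.
  rewrite -sr2 -exprMn; set s := Num.sqrt _ in sr d3r *.
  have : (s * delta3) ^+ 2 <= (1 / 4) ^+ 2.
    rewrite lerXn2r// ?nnegrE ?mulr_ge0 ?(ltW d30) ?(le_trans ler01 sr)//.
    lra.
  lra.
have aG : alpha * (Lip W t + 2 * M * rgrad_max d r W t) <= 2.
  (* If [D] is not positive, alpha D <= 0 and the bound is immediate. *)
  set D := Lip W t + _ in hG *; have [D0|D0] := ltP 0 D; first by rewrite -ler_pdivlMr.
  by apply: (@le_trans _ _ 0) => //; rewrite pmulr_rle0.
have phiS k : phi W t (x k.+1) <= phi W t (x k).
  exact: (phi_step r_ge1 N_ge2 hW t_ge1 alpha_gt0 (x_st k) (x_st k.+1) (hx k) hM).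
have phik0 k : phi W t (x k) <= phi W t (x 0%N).
  by elim: k => // k; exact: le_trans (phiS k).
set gam := gamma_l _ _ _ _.
(* Both losses, 4 r delta3^2 mu and phi(x_0), are at most mu / 4. *)
have g0 : 0 <= gam.
  rewrite /gam /gamma_l; have : mu W t * (r%:R * delta3 ^+ 2) <= mu W t * (1 / 16).
    by rewrite ler_pM2l.
  move: phi0; move: (phi _ _ _) => p; lra.
have stepk k : a k <= N%:R * delta3 ^+ 2 ->
    a k.+1 <= (1 - 2 * alpha * (1 - 1 / 2) * gam) * a k.
  move=> hA; have /divL hc : alpha <= (1 / 2) * (2 - a k) / Lip W t.
    by apply: le_trans (halpha k) _; rewrite invfM -/(a k) le_eqVlt; apply/orP;
      left; apply/eqP; ring.
  have := decr k (a k) (1 / 2) (fnorm_le_tuple _) hc.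
  move=> /le_trans; apply; rewrite [X in _ <= X]mulrBl [1 * a k]mul1r lerD2l lerN2.
  rewrite -[X in X <= _]mulrA.
  apply: ler_wpM2l; first by rewrite !mulr_ge0 ?(ltW alpha_gt0)//; lra.
  have := phi_dev k (delta3 ^+ 2) (sqr_ge0 _) hA.
  (* Here c = a_k, and (2 - a_k) phi(x_k) loses a_k phi(x_k); monotonicity charges it to phi(x_0),
     the origin of the subtracted term in [gamma_l]. *)
  have : phi W t (x k) * a k <= phi W t (x 0%N) * a k by rewrite ler_wpM2r.
  rewrite /gam /gamma_l; set p := phi _ _ (x k); set p0 := phi _ _ (x 0%N).
  set m := mu W t * _; lra.
have hA k : a k <= N%:R * delta3 ^+ 2.
  elim: k => // k IHk; apply: le_trans (stepk k IHk) _; apply: le_trans IHk.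
  rewrite ler_piMl// gerBl !mulr_ge0 ?(ltW alpha_gt0)//; lra.
by apply: geometric_decay => // k; exact: stepk.
Qed.
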